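(* Let $\varphi$ be a 3iet preserving morphism on the alphabet $\{A,B,C\}$ and let $\boldsymbol{M}$ be its incidence matrix. Then one of the following holds: (i) $\det\boldsymbol{M}\in\{1,-1\}$ and $\varphi(u)$ is non-degenerated for every non-degenerated 3iet word $u$; (ii) $\det\boldsymbol{M}=0$ and $\varphi(u)$ is degenerated for every 3iet word $u$.
   Context: 3-interval exchange transformation (3iet): let $\alpha,\beta,\gamma>0$ be real. Put either $I_A=[0,\alpha)$, $I_B=[\alpha,\alpha+\beta)$, $I_C=[\alpha+\beta,\alpha+\beta+\gamma)$, or $I_A=(0,\alpha]$, $I_B=(\alpha,\alpha+\beta]$, $I_C=(\alpha+\beta,\alpha+\beta+\gamma]$, and $I=I_A\cup I_B\cup I_C$. The 3iet with parameters $\alpha,\beta,\gamma$ is the bijection $T:I\to I$ given by $T(x)=x+\beta+\gamma$ for $x\in I_A$, $T(x)=x-\alpha+\gamma$ for $x\in I_B$, $T(x)=x-\alpha-\beta$ for $x\in I_C$. For $x_0\in I$, the word $u_T(x_0)=(u_n)_{n\in\mathbb{Z}}\in\{A,B,C\}^{\mathbb{Z}}$ coding the orbit of $x_0$ is defined by $u_n=X$ if $T^n(x_0)\in I_X$, $X\in\{A,B,C\}$. A biinfinite word $(u_n)_{n\in\mathbb{Z}}$ is aperiodic if neither $u_0u_1u_2\cdots$ nor $\cdots u_{-3}u_{-2}u_{-1}$ is eventually periodic. A 3iet word is an aperiodic word of the form $u_T(x_0)$ for some 3iet $T$ (with either choice of domain) and some $x_0\in I$. The complexity $\mathcal{C}_u(n)$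 of a word $u$ is the number of distinct factors (blocks of consecutive letters) of length $n$ of $u$. A 3iet word $u$ is non-degenerated if $\mathcal{C}_u(n)=2n+1$ for all $n\in\mathbb{N}$; otherwise it is degenerated. A morphism $\varphi$ on $\{A,B,C\}$ is a monoid homomorphism $\{A,B,C\}^*\to\{A,B,C\}^*$; it acts on biinfinite words by $\varphi(\cdots u_{-2}u_{-1}|u_0u_1\cdots)=\cdots\varphi(u_{-2})\varphi(u_{-1})|\varphi(u_0)\varphi(u_1)\cdots$, where $|$ marks the position just before index $0$. It is 3iet preserving if $\varphi(u)$ is a 3iet word for every 3iet word $u$. The incidence matrix of $\varphi$, with the letters ordered $a_1=A,a_2=B,a_3=C$, is the $3\times3$ matrix $\boldsymbol{M}$ whose $(i,j)$ entry is the number of occurrences of $a_j$ in $\varphi(a_i)$. *)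

(* Defs.v *)
From mathcomp Require Import all_boot all_order all_algebra.
From mathcomp Require Import boolp classical_sets functions reals.
From mathcomp Require Import lra zify.

Set Implicit Arguments.
Unset Strict Implicit.
Unset Printing Implicit Defensive.
Import Order.TTheory GRing.Theory Num.Theory.
Local Open Scope ring_scope.

(* The alphabet {A, B, C}, in this order, is 'I_3, so that letters directly
   index the rows and columns of incidence matrices. *)
Definition letter := 'I_3.
Definition lA : letter := @Ordinal 3 0 isT.
Definition lB : letter := @Ordinal 3 1 isT.
Definition lC : letter := @Ordinal 3 2 isT.

Definition biword := int -> letter.

Definition factor (u : biword) (i : int) (n : nat) : seq letter :=
  mkseq (fun k => u (i + k%:Z)) n.

Definition complexity (u : biword) (n : nat) : nat :=
  #|[pred w : n.-tuple letter | `[< exists i, factor u i n = w >]]|.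

Definition eventually_periodic (s : nat -> letter) : Prop :=
  exists p N : nat, (0 < p)%N /\ forall n, (N <= n)%N -> s (n + p)%N = s n.

(* The left half is read leftwards: u_{-1}, u_{-2}, u_{-3}, etc. *)
Definition aperiodic (u : biword) : Prop :=
  ~ eventually_periodic (fun n => u n%:Z) /\
  ~ eventually_periodic (fun n => u (- (n.+1)%:Z)).

(* [iet_left] selects the domain: if true the three intervals are
   [0, a[, [a, a + b[, [a + b, a + b + c[, if false they are
   ]0, a], ]a, a + b], ]a + b, a + b + c]. *)
Record iet (R : realType) := Iet {
  iet_a : R;
  iet_b : R;
  iet_c : R;
  iet_left : bool;
  iet_a_gt0 : 0 < iet_a;
  iet_b_gt0 : 0 < iet_b;
  iet_c_gt0 : 0 < iet_c }.

Section Iet.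
Variables (R : realType) (T : iet R).
Let a := iet_a T.
Let b := iet_b T.
Let c := iet_c T.

(* BSide true x is the bound BLeft x, and BSide false x is BRight x. *)
Definition iet_itv (X : letter) : interval R :=
  let J x y := Interval (BSide (iet_left T) x) (BSide (iet_left T) y) in
  if X == lA then J 0 a
  else if X == lB then J a (a + b)
  else J (a + b) (a + b + c).

Definition iet_dom : set R :=
  ([set` iet_itv lA] `|` [set` iet_itv lB] `|` [set` iet_itv lC])%classic.

(* Only the values on [iet_dom] are meaningful. *)
Definition iet_map (x : R) : R :=
  if x \in iet_itv lA then x + b + c
  else if x \in iet_itv lB then x - a + c
  else x - a - b.

Lemma iet_domE : iet_dom =
  [set` Interval (BSide (iet_left T) 0) (BSide (iet_left T) (a + b + c))]%classic.
Proof.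
have a0 : 0 < a := iet_a_gt0 T.
have b0 : 0 < b := iet_b_gt0 T.
have c0 : 0 < c := iet_c_gt0 T.
rewrite /iet_dom /iet_itv /=; case: (iet_left T);
  apply/seteqP; split => x /=; rewrite !in_itv /=.
- by move=> [[]|]; lra.
- move=> h; have [h1|h1] := ltP x a; first by left; left; lra.
  by have [h2|h2] := ltP x (a + b); [left; right|right]; lra.
- by move=> [[]|]; lra.
- move=> h; have [h1|h1] := leP x a; first by left; left; lra.
  by have [h2|h2] := leP x (a + b); [left; right|right]; lra.
Qed.

Lemma iet_map_bij : set_bij iet_dom iet_dom iet_map.
Proof.
have a0 : 0 < a := iet_a_gt0 T.
have b0 : 0 < b := iet_b_gt0 T.
have c0 : 0 < c := iet_c_gt0 T.
rewrite iet_domE /iet_map /iet_itv /=; case: (iet_left T); split.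
- move=> x /=; rewrite !in_itv /=; case: (boolP (0 <= x < a)) => ?;
    case: (boolP (a <= x < a + b)) => ?; lra.
- move=> x y /set_mem /= + /set_mem /=; rewrite !in_itv /=.
  case: (boolP (0 <= x < a)) => ?; case: (boolP (a <= x < a + b)) => ?;
  case: (boolP (0 <= y < a)) => ?; case: (boolP (a <= y < a + b)) => ?; lra.
- move=> y /=; rewrite !in_itv /= => hy.
  have [h|h] := boolP (y < c); last have [h'|h'] := boolP (y < b + c).
  + exists (y + a + b); rewrite /= !in_itv /=; first by lra.
    by case: ifPn => [|_]; last case: ifPn => [|_]; lra.
  + exists (y + a - c); rewrite /= !in_itv /=; first by lra.
    by case: ifPn => [|_]; last case: ifPn => [|]; lra.
  + exists (y - b - c); rewrite /= !in_itv /=; first by lra.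
    by case: ifPn => [|]; lra.
- move=> x /=; rewrite !in_itv /=; case: (boolP (0 < x <= a)) => ?;
    case: (boolP (a < x <= a + b)) => ?; lra.
- move=> x y /set_mem /= + /set_mem /=; rewrite !in_itv /=.
  case: (boolP (0 < x <= a)) => ?; case: (boolP (a < x <= a + b)) => ?;
  case: (boolP (0 < y <= a)) => ?; case: (boolP (a < y <= a + b)) => ?; lra.
- move=> y /=; rewrite !in_itv /= => hy.
  have [h|h] := boolP (y <= c); last have [h'|h'] := boolP (y <= b + c).
  + exists (y + a + b); rewrite /= !in_itv /=; first by lra.
    by case: ifPn => [|_]; last case: ifPn => [|_]; lra.
  + exists (y + a - c); rewrite /= !in_itv /=; first by lra.
    by case: ifPn => [|_]; last case: ifPn => [|]; lra.
  + exists (y - b - c); rewrite /= !in_itv /=; first by lra.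
    by case: ifPn => [|]; lra.
Qed.

(* The inverse is that of the bijection of [iet_map_bij]. *)
Definition iet_inv : R -> R := 'pinv_(fun=> 0) iet_dom iet_map.

Definition iet_iter (n : int) (x : R) : R :=
  match n with
  | Posz k => iter k iet_map x
  | Negz k => iter k.+1 iet_inv x
  end.

Definition codes_orbit (x0 : R) (u : biword) : Prop :=
  forall n X, iet_iter n x0 \in iet_itv X -> u n = X.

End Iet.

Definition is_3iet_word (R : realType) (u : biword) : Prop :=
  aperiodic u /\
  exists (T : iet R) (x0 : R), iet_dom T x0 /\ codes_orbit T x0 u.

Definition nondegenerated_3iet_word (R : realType) (u : biword) : Prop :=
  is_3iet_word R u /\ forall n, complexity u n = (2 * n + 1)%N.

Definition degenerated_3iet_word (R : realType) (u : biword) : Prop :=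
  is_3iet_word R u /\ ~ forall n, complexity u n = (2 * n + 1)%N.

Definition is_morphism (phi : seq letter -> seq letter) : Prop :=
  phi [::] = [::] /\ forall s t, phi (s ++ t) = phi s ++ phi t.

(* [v] is phi(u). As phi may erase letters, phi(u) is a biinfinite word only
   if the images of the two halves of u are infinite, which is required here;
   [v] is then unique, see [is_image_unique]. *)
Definition is_image (phi : seq letter -> seq letter) (u v : biword) : Prop :=
  [/\ forall n : nat, let w := phi (factor u 0 n) in
        factor v 0 (size w) = w,
      forall n : nat, let w := phi (factor u (- n%:Z) n) in
        factor v (- (size w)%:Z) (size w) = w,
      forall N : nat, exists n : nat, (N <= size (phi (factor u 0 n)))%N
    & forall N : nat, exists n : nat,
        (N <= size (phi (factor u (- n%:Z) n)))%N].

Lemma is_image_unique phi u v v' : is_image phi u v -> is_image phi u v' ->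
  v =1 v'.
Proof.
move=> [r l hr hl] [r' l' _ _] [k|k].
  have [n hn] := hr k.+1.
  have := r n; rewrite /= -{2}(r' n) => /(congr1 (fun s => nth lA s k)).
  by rewrite !nth_mkseq // add0r.
have [n hn] := hl k.+1.
have := l n; rewrite /= -{3}(l' n); set m := size _ in hn *.
move=> /(congr1 (fun s => nth lA s (m - k.+1)%N)).
rewrite !nth_mkseq; [|lia..].
by have -> : - m%:Z + (m - k.+1)%N%:Z = Negz k by lia.
Qed.

Definition preserves_3iet (R : realType) (phi : seq letter -> seq letter) :=
  forall u, is_3iet_word R u -> exists2 v, is_image phi u v & is_3iet_word R v.

Definition incidence_mx (phi : seq letter -> seq letter) : 'M[int]_3 :=
  \matrix_(i < 3, j < 3) (count_mem j (phi [:: i]))%:Z.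

(* Main.v *)
Require Import Defs.
From mathcomp Require Import all_boot all_order all_algebra.
From mathcomp Require Import boolp classical_sets functions reals.
From mathcomp Require Import ring lra zify.

Set Implicit Arguments.
Unset Strict Implicit.
Unset Printing Implicit Defensive.
Import Order.TTheory GRing.Theory Num.Theory.
Local Open Scope ring_scope.

(** Write A as 0, B as 01 and C as 1: the coding of an exchange [T] with lengths
    [a], [b], [c] becomes the coding of a rotation whose two arcs have lengths
    [down = a + b] and [up = b + c], and [T] is the map induced by this rotation on
    an interval of length [up + down - b]. Everything below is expressed with the
    lattice [L] of the integer combinations of [up] and [down]: a coding is
    aperiodic iff [up] and [down] are incommensurable; the orbit of [x0] is then
    the dense set of the points of the domain congruent to [x0] modulo [L]
    ([trace_reaches]); and the coding is degenerate iff the two discontinuities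
    [a] and [a + b] share an orbit, that is iff [b] lies in [L]
    ([complexity_nondegenerate], [complexity_degenerate]).

    Let [M] be the incidence matrix. Letters have frequencies proportional to the
    lengths ([frequency]), so the image of a coding of [T] is a coding of an exchange
    [T'] whose lengths are, up to scaling, the lengths of [T] times [M]
    ([image_trace]). The numbers [up'] and [down'] of [T'] must be incommensurable
    whenever [up] and [down] are, whatever the value of [b]. Moving [b] while
    [up] and [down] stay fixed moves [(down', up')] along a segment in an integer
    direction, which would meet rational slopes were it not reduced to a point
    ([counts_additive]). Hence [up'] and [down'] are integer combinations of [up] and
    [down], with a nonzero determinant [d]; moreover [(1, -1, 1) M = k (1, -1, 1)] for
    some integer [k], [det M = k d], and [b'] is congruent to [k b] modulo [L].

    It remains to show that [d] is 1 or -1, so that the lattice [L'] of [T'] is [L],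
    and that [k] is 0, 1 or -1. If [k] is 0 then [b'] lies in [L' = L] and all images
    are degenerate; otherwise [b'] lies in [L'] iff [b] lies in [L].

    For both claims, take [b] free modulo [L]. The displacement of [T'] along the
    image of a letter is [d] times the displacement of [T], so the points of the
    orbit of [T'] at the beginnings of the blocks are the image of the orbit of [T]
    under an affine map of slope [d], and the domain of [T'] is covered by translates
    of the images of the three intervals of [T], which we call tiles. Each interval
    of [T'] begins where some tile begins ([tile_exists]). The ends of the intervals
    of [T] are congruent to 0 or to [- b], so [b'], a difference of two beginnings, is
    congruent to 0, [d b] or [- d b], and [k] is 0, [d] or [- d] ([kphi_dphi]). If [d]
    were not a unit, two distinct orbits of [T] would have affine images lying in
    one orbit of [T'], which would thus be cut into blocks in two ways; near the left
    end of an interval of [T'] these two ways yield two tiles with a common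
    beginning, and a nontrivial multiple of [b] in [L] ([dphi_unit]). *)

(** * Sequences indexed by the integers *)

Lemma int_step_ind (P : int -> Prop) : P 0 ->
  (forall n, P n <-> P (n + 1)) -> forall n, P n.
Proof.
move=> P0 PS [] k; elim: k => [|k IH] //.
- by rewrite -addn1 PoszD; apply: (PS _).1.
- exact: (PS _).2.
- apply: (PS _).2; suff -> : Negz k.+1 + 1 = Negz k by [].
  by rewrite !NegzE; lia.
Qed.

(** The discrete antiderivative of [f] on the integers vanishing at 0. *)
Definition prim (V : zmodType) (f : int -> V) (n : int) : V :=
  match n with
  | Posz k => \sum_(i < k) f i%:Z
  | Negz k => - \sum_(i < k.+1) f (Negz i)
  end.

Lemma prim0 (V : zmodType) (f : int -> V) : prim f 0 = 0.
Proof. by rewrite /= big_ord0. Qed.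

Lemma primS (V : zmodType) (f : int -> V) n : prim f (n + 1) = prim f n + f n.
Proof.
case: n => [k|[|k]].
- by rewrite -PoszD addn1 /= big_ord_recr.
- by have -> : Negz 0 + 1 = 0 by []; rewrite prim0 /= big_ord1 addNr.
- have -> : Negz k.+1 + 1 = Negz k by rewrite !NegzE; lia.
  by rewrite /= [in RHS]big_ord_recr /= opprD addrNK.
Qed.

Lemma prim_unique (V : zmodType) (f g : int -> V) : g 0 = 0 ->
  (forall n, g (n + 1) = g n + f n) -> forall n, g n = prim f n.
Proof.
move=> g0 gS; apply: int_step_ind; first by rewrite prim0.
by move=> n; rewrite gS primS; split=> [->//|/addIr].
Qed.

Lemma int_crossing (f : int -> int) (m n n' : int) :
  f n <= m -> m < f n' -> n <= n' ->
  exists k, f k <= m < f (k + 1).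
Proof.
move=> fn fn' nn'.
have [d dE] : exists d : nat, n' = n + d%:Z by exists `|n' - n|%N; lia.
move: fn'; rewrite {nn'}dE; elim: d => [|d IH] h; first by rewrite addr0 in h; lia.
have [h'|h'] := ltP m (f (n + d%:Z)); first exact: IH.
by exists (n + d%:Z); rewrite h' /= -addrA -PoszD addn1.
Qed.

Lemma prim_crossing (f : int -> int) (m : int) : (forall n, 1 <= f n) ->
  exists k, prim f k <= m < prim f k + f k.
Proof.
move=> f1.
have up (n : nat) : n%:Z <= prim f n.
  elim: n => [|n IH]; first by rewrite prim0.
  by rewrite -addn1 PoszD primS; have := f1 n; lia.
have down (n : nat) : prim f (- n%:Z) <= - n%:Z.
  elim: n => [|n IH]; first by rewrite oppr0 prim0.
  have e : - n%:Z = - n.+1%:Z + 1 by lia.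
  by move: IH; rewrite {1}e primS; have := f1 (- n.+1%:Z); lia.
have [k] : exists k, prim f k <= m < prim f (k + 1).
  apply: (@int_crossing _ _ (- `|m|%N%:Z) `|m|%N.+1%:Z); last by lia.
    by have := down `|m|%N; lia.
  by have := up `|m|%N.+1; lia.
by rewrite primS; exists k.
Qed.

(** * Orbits of an exchange of three intervals *)

Lemma letterP (X : letter) : [\/ X = lA, X = lB | X = lC].
Proof.
by case: X => [[|[|[|//]]]] i;
  [constructor 1|constructor 2|constructor 3]; apply: val_inj.
Qed.

Lemma sum_letter (V : nmodType) (f : letter -> V) :
  \sum_X f X = f lA + f lB + f lC.
Proof.
rewrite !big_ord_recl big_ord0 addr0 addrA.
by congr (f _ + f _ + f _); apply: val_inj.
Qed.

(** Writing A as 0, B as 01 and C as 1 turns the coding of an orbit into the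
    coding of an orbit of a rotation; [zeros] and [ones] count the letters of
    the resulting binary word. *)
Notation zeros w := (count (fun X => X != lC) w).
Notation ones w := (count (fun X => X != lA) w).

Lemma count_letters (w : seq letter) :
  [/\ size w = (count_mem lA w + count_mem lB w + count_mem lC w)%N,
      zeros w = (count_mem lA w + count_mem lB w)%N &
      ones w = (count_mem lB w + count_mem lC w)%N].
Proof.
elim: w => [|X w [IH1 IH2 IH3]]; first by split.
case: (letterP X) => -> /=; move: IH1 IH2 IH3; rewrite !add0n;
  move: (size w) (zeros w) (ones w) (count_mem lA w) (count_mem lB w)
    (count_mem lC w) => s z o p q r IH1 IH2 IH3; split; lia.
Qed.

Section Exchange.
Variables (R : realType) (T : iet R).
Local Notation a := (iet_a T).
Local Notation b := (iet_b T).
Local Notation c := (iet_c T).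

(** [T] is the first return map to an interval of length [total] of the
    rotation of a circle of length [up + down] which moves a point to the right
    by [up] or, equivalently, to the left by [down]. *)
Definition up : R := b + c.
Definition down : R := a + b.
Definition total : R := a + b + c.

Definition len (X : letter) : R := if X == lA then a else if X == lB then b else c.
Definition lo (X : letter) : R :=
  if X == lA then 0 else if X == lB then a else a + b.
Definition hi (X : letter) : R := lo X + len X.

Definition shift (X : letter) : R :=
  (X != lC)%:R * up - (X != lA)%:R * down.

Definition shiftw (w : seq letter) : R := \sum_(X <- w) shift X.

(** The points and the letters of an orbit, both carried along: unlike the
    iterates of [T], this notion is visibly stable under scaling and reflection. *)
Definition trace (x : int -> R) (u : biword) : Prop :=
  forall n, x n \in iet_itv T (u n) /\ x (n + 1) = x n + shift (u n).

Definition lattice (z : R) : Prop :=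
  exists i j : int, z = i%:~R * up + j%:~R * down.

Definition irrational : Prop := forall i j : int,
  i%:~R * up = j%:~R * down -> i = 0 /\ j = 0.

Lemma abc_gt0 : [/\ 0 < a, 0 < b & 0 < c].
Proof. by split; [apply: iet_a_gt0|apply: iet_b_gt0|apply: iet_c_gt0]. Qed.

Lemma mem_itvE X x : x \in iet_itv T X =
  if iet_left T then lo X <= x < hi X else lo X < x <= hi X.
Proof.
rewrite /iet_itv /hi /lo /len.
by case: (letterP X) => ->; rewrite /= ?add0r; case: (iet_left T);
  rewrite in_itv.
Qed.

Lemma mem_domE x : iet_dom T x <->
  if iet_left T then 0 <= x < total else 0 < x <= total.
Proof. by rewrite iet_domE /=; case: (iet_left T); rewrite in_itv. Qed.

Lemma itv_bounds X x : x \in iet_itv T X -> lo X <= x <= hi X.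
Proof. by rewrite mem_itvE; case: ifP => _; lra. Qed.

Lemma itv_interior X x : lo X < x < hi X -> x \in iet_itv T X.
Proof. by rewrite mem_itvE; case: ifP => _; lra. Qed.

Lemma dom_interior x : 0 < x < total -> iet_dom T x.
Proof. by move=> ?; apply/mem_domE; case: ifP => _; lra. Qed.

Lemma itv_dom X x : x \in iet_itv T X -> iet_dom T x.
Proof.
have [a0 b0 c0] := abc_gt0; move=> xX; apply/mem_domE; move: xX.
rewrite mem_itvE /lo /hi /lo /len /total; case: (iet_left T);
  by case: (letterP X) => -> /=; lra.
Qed.

Lemma itv_inj X Y x : x \in iet_itv T X -> x \in iet_itv T Y -> X = Y.
Proof.
have [a0 b0 c0] := abc_gt0.
rewrite !mem_itvE /hi /lo /len; case: (iet_left T);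
  by case: (letterP X) => ->; case: (letterP Y) => -> //= *; exfalso; lra.
Qed.

Lemma dom_letter x : iet_dom T x -> exists X, x \in iet_itv T X.
Proof. by case=> [[]|] /= h; [exists lA|exists lB|exists lC]. Qed.

Lemma iet_mapE X x : x \in iet_itv T X -> iet_map T x = x + shift X.
Proof.
move=> xX; rewrite /iet_map.
case: ifP => [/itv_inj/(_ xX) <-|xA].
  by rewrite /shift /up /=; lra.
case: ifP => [/itv_inj/(_ xX) <-|xB].
  by rewrite /shift /up /down /=; lra.
case: (letterP X) xX xA xB => -> => [->|->|] // _ _ _.
by rewrite /shift /up /down /=; lra.
Qed.

Lemma iet_invP x : iet_dom T x ->
  iet_dom T (iet_inv T x) /\ iet_map T (iet_inv T x) = x.
Proof.
have [_ fI fS] := iet_map_bij T; move=> /fS[z zd <-].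
by rewrite /iet_inv (pinvKV _ fI) //; apply/mem_set.
Qed.

Lemma iet_iter_dom x0 n : iet_dom T x0 -> iet_dom T (iet_iter T n x0).
Proof.
have [fM _ _] := iet_map_bij T; move=> x0d.
case: n => k; elim: k => [|k IH] //; first exact: fM.
- exact: (iet_invP x0d).1.
- exact: (iet_invP IH).1.
Qed.

Lemma trace_exists x0 : iet_dom T x0 ->
  exists x u, [/\ x 0 = x0, trace x u & codes_orbit T x0 u].
Proof.
move=> x0d; pose x n := iet_iter T n x0.
have xd n : iet_dom T (x n) := iet_iter_dom n x0d.
have xS n : x (n + 1) = iet_map T (x n).
  case: n => [k|[|k]].
  - by rewrite -PoszD addn1.
  - by rewrite /x /= (iet_invP x0d).2.
  - have -> : Negz k.+1 + 1 = Negz k by rewrite !NegzE; lia.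
    by rewrite [in RHS]/x /= (iet_invP (xd (Negz k))).2.
have [u uP] := choice (fun n => dom_letter (xd n)).
exists x, u; split=> // [n|n X].
  by split; [exact: uP|rewrite xS (iet_mapE (uP n))].
by move=> /(itv_inj (uP n)).
Qed.

Lemma shiftwE w : shiftw w =
  (zeros w)%:R * up - (ones w)%:R * down.
Proof.
rewrite /shiftw; elim: w => [|X w IH]; first by rewrite big_nil !mul0r subrr.
by rewrite big_cons IH /shift /= !natrD; ring.
Qed.

Lemma shiftw1 X : shiftw [:: X] = shift X.
Proof. exact: big_seq1. Qed.

Lemma shiftw_cat w w' : shiftw (w ++ w') = shiftw w + shiftw w'.
Proof. by rewrite /shiftw big_cat. Qed.

Lemma lattice_shiftw w : lattice (shiftw w).
Proof.
exists (zeros w)%:Z, (- (ones w)%:Z).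
by rewrite shiftwE mulrNz -!pmulrn; ring.
Qed.

Lemma lattice_up : lattice up.
Proof. by exists 1, 0; rewrite mul0r addr0 mul1r. Qed.

Lemma lattice_down : lattice down.
Proof. by exists 0, 1; rewrite mul0r add0r mul1r. Qed.

Lemma latticeD y z : lattice y -> lattice z -> lattice (y + z).
Proof.
move=> [i [j ->]] [k [l ->]]; exists (i + k), (j + l).
by rewrite !rmorphD /=; ring.
Qed.

Lemma latticeN z : lattice z -> lattice (- z).
Proof.
by move=> [i [j ->]]; exists (- i), (- j); rewrite !rmorphN /=; ring.
Qed.

Lemma latticeB y z : lattice y -> lattice z -> lattice (y - z).
Proof. by move=> hy /latticeN; apply: latticeD. Qed.

Lemma latticeMz (k : int) z : lattice z -> lattice (k%:~R * z).
Proof.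
move=> [i [j ->]]; exists (k * i), (k * j); rewrite !rmorphM /=; ring.
Qed.

Lemma lattice0 : lattice 0.
Proof. by exists 0, 0; rewrite !mul0r addr0. Qed.

Lemma shiftw_eq0 w : irrational -> shiftw w = 0 -> w = [::].
Proof.
move=> irr; rewrite shiftwE => /subr0_eq h.
have /irr[] : (zeros w)%:Z%:~R * up =
  (ones w)%:Z%:~R * down by rewrite -!pmulrn.
case: w {h} => [//|X w] /= h1 h2.
by case: (letterP X) h1 h2 => -> /=; lia.
Qed.

End Exchange.

Section Traces.
Variables (R : realType) (T : iet R) (x : int -> R) (u : biword).
Hypothesis xu : trace T x u.

Lemma trace_dom n : iet_dom T (x n).
Proof. by case: (xu n) => /itv_dom. Qed.

Lemma trace_factor n k : x (n + k%:Z) = x n + shiftw T (factor u n k).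
Proof.
elim: k => [|k IH]; first by rewrite /factor /= /shiftw big_nil !addr0.
rewrite -addn1 PoszD addrA (xu _).2 IH /factor addn1 mkseqS -cats1 shiftw_cat.
by rewrite shiftw1 -addrA.
Qed.

Lemma trace_prim n : x n = x 0 + prim (fun m => shift T (u m)) n.
Proof.
rewrite -(@prim_unique _ _ (fun n => x n - x 0)) ?subrr 1?addrC ?subrK //.
by move=> m; rewrite (xu m).2 addrAC.
Qed.

Lemma trace_lattice n : lattice T (x n - x 0).
Proof.
rewrite trace_prim addrC addKr; move: n; apply: int_step_ind.
  by rewrite prim0; apply: lattice0.
move=> n; rewrite primS; have h : lattice T (shift T (u n)).
  by have := lattice_shiftw T [:: u n]; rewrite /shiftw big_seq1.
by split=> [/latticeD/(_ h)//|/latticeB/(_ h)]; rewrite addrK.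
Qed.

(** Time is measured here by the rotation of which [T] is a first return map:
    a letter [lB] takes two steps of it, the other letters one. If the point
    wanted were reached in the middle of a letter [lB], it would lie outside
    the interval on which [T] acts. *)
Lemma trace_reaches_steps y (i j : int) :
  iet_dom T y -> y = x 0 + i%:~R * up T - j%:~R * down T ->
  exists n, x n = y /\
    prim (fun m => (u m != lC)%:Z + (u m != lA)%:Z) n = i + j.
Proof.
move=> yd yE.
pose F m := (u m != lC)%:Z; pose G m := (u m != lA)%:Z.
have FG1 n : 1 <= F n + G n.
  by rewrite /F /G; case: (letterP (u n)) => ->.
have [n nP] := prim_crossing (i + j) FG1.
exists n.
have primD m : prim (fun m => F m + G m) m = prim F m + prim G m.
  apply/esym; move: m; apply: prim_unique; first by rewrite !prim0.
  by move=> m; rewrite !primS; ring.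
have xn : x n = x 0 + (prim F n)%:~R * up T - (prim G n)%:~R * down T.
  rewrite trace_prim -addrA; congr (_ + _); apply/esym; move: (n).
  apply: prim_unique; first by rewrite !prim0 !mul0r subrr.
  move=> m; rewrite !primS /shift !rmorphD /= /F /G -!pmulrn; ring.
have [a0 b0 c0] := abc_gt0 T.
have xnd := (xu n).1.
have yb := (mem_domE T y).1 yd; have xb := (mem_domE T _).1 (trace_dom n).
rewrite /total in yb xb.
have key (z s : R) (k : int) : z = s + k%:~R * (up T + down T) ->
    `|z - s| < up T + down T -> k = 0.
  move=> -> ; rewrite addrC addKr normrM (gtr0_norm (_ : 0 < up T + down T)).
    rewrite -[ltRHS]mul1r ltr_pM2r; last by rewrite /up /down; lra.
    by rewrite -intr_norm ltrz1; lia.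
  by rewrite /up /down; lra.
rewrite primD in nP *.
have [eq1|eq1] : prim F n + prim G n = i + j \/
  (prim F n + prim G n + 1 = i + j /\ u n = lB).
- move: nP; rewrite /F /G.
  case: (letterP (u n)) => e; rewrite e /=; [left; lia| |left; lia].
  move=> h; have [h'|h'] : prim F n + prim G n = i + j \/
      prim F n + prim G n + 1 = i + j by rewrite /F /G; lia.
    by left.
  by right.
- split=> //; have jE : j = prim F n + prim G n - i by lia.
  suff i0 : prim F n - i = 0.
    have e : i = prim F n by lia.
    have e' : j = prim G n by lia.
    by rewrite xn yE e e'.
  apply: (key (x n) y).
    rewrite xn yE jE !rmorphB !rmorphD /=; ring.
  rewrite /up /down; move: yb xb; case: (iet_left T) => yb xb;
    by rewrite ltr_norml; lra.
- exfalso; case: eq1 => eq1 uB.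
  have jE : j = prim F n + prim G n + 1 - i by lia.
  have h : prim F n + 1 - i = 0.
    apply: (key (x n + up T) y).
      rewrite xn yE jE !rmorphB !rmorphD /=; ring.
    move: xnd; rewrite uB mem_itvE /lo /hi /lo /len /=.
    rewrite /up /down; move: yb {xb}; case: (iet_left T) => yb xb;
      by rewrite ltr_norml; lra.
  have e : i = prim F n + 1 by lia.
  have jE' : j = prim G n by lia.
  have : y = x n + up T by rewrite yE xn e jE' rmorphD /=; ring.
  move: xnd; rewrite uB mem_itvE /lo /hi /lo /len /= /up.
  by move: yb {xb}; case: (iet_left T); lra.
Qed.

Lemma trace_reaches y : iet_dom T y -> lattice T (y - x 0) -> exists n, x n = y.
Proof.
move=> yd [i [j ij]].
have yE : y = x 0 + i%:~R * up T - (- j)%:~R * down T.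
  by rewrite rmorphN /= mulNr opprK -addrA -ij addrC subrK.
by have [n [nE _]] := trace_reaches_steps yd yE; exists n.
Qed.

Lemma trace_inj : irrational T -> injective x.
Proof.
move=> irr.
have le (n : int) k : x (n + k%:Z) = x n -> k = 0%N.
  rewrite trace_factor => /eqP; rewrite -[eqbRHS]addr0 (inj_eq (addrI _)).
  by move=> /eqP/(shiftw_eq0 irr)/(congr1 size); rewrite size_mkseq.
move=> n m h; have [nm|nm] := leP n m.
  have := le n `|m - n|%N; have -> : n + `|m - n|%N%:Z = m by lia.
  by move=> /(_ (esym h)); lia.
have := le m `|n - m|%N; have -> : m + `|n - m|%N%:Z = n by lia.
by move=> /(_ h); lia.
Qed.

(** A relation between [up] and [down] closes the orbit of the rotation, hence
    that of [T], up to periodicity of the coding. *)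
Lemma aperiodic_irrational : aperiodic u -> irrational T.
Proof.
move=> [ap _] i j ij; apply: contrapT => nij; apply: ap.
have [a0 b0 c0] := abc_gt0 T.
have up0 : 0 < up T by rewrite /up; lra.
have down0 : 0 < down T by rewrite /down; lra.
have [k [l [kl klE]]] : exists k l : int, 0 < k + l /\
    k%:~R * up T = l%:~R * down T.
  have [h|h] := ltP 0 (i + j); first by exists i, j.
  exists (- i), (- j); split; last by rewrite !rmorphN /= !mulNr ij.
  suff : i + j != 0 by lia.
  apply: contra_notN nij => /eqP ij0.
  have e : j = - i by lia.
  suff i0 : i = 0 by rewrite e i0.
  move: ij; rewrite e rmorphN /= mulNr => /eqP.
  rewrite -addr_eq0 -mulrDr mulf_eq0 => /orP[|]; last by move/eqP => *; exfalso; lra.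
  by rewrite intr_eq0 => /eqP.
have [n [xn rn]] : exists n, x n = x 0 /\
    prim (fun m => (u m != lC)%:Z + (u m != lA)%:Z) n = k + l.
  apply: trace_reaches_steps (trace_dom 0) _.
  by rewrite klE addrK.
have n0 : 0 < n.
  case: n rn {xn} => [[|m] /=|m /=] h //; first by rewrite big_ord0 in h; lia.
  by exfalso; move: kl; rewrite -h oppr_gt0 ltNge sumr_ge0.
have per q : x (n + q%:Z) = x q%:Z.
  elim: q => [|q IH]; first by rewrite addr0 xn.
  rewrite -addn1 PoszD addrA (xu _).2 IH (xu q).2; congr (_ + shift T _).
  by apply: itv_inj (xu _).1 _; rewrite IH; exact: (xu _).1.
exists `|n|%N, 0%N; split; first by lia.
move=> q _; apply: itv_inj (xu _).1 _.
have -> : (q + `|n|)%N%:Z = n + q%:Z by lia.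
by rewrite per; exact: (xu _).1.
Qed.

(** Over a period the orbit would move by a fixed amount, which vanishes since
    the orbit is bounded. *)
Lemma irrational_aperiodic : irrational T -> aperiodic u.
Proof.
move=> irr.
have inj := trace_inj irr.
have bnd n : 0 <= x n <= total T.
  by have /mem_domE := trace_dom n; case: (iet_left T); lra.
have const (f : nat -> R) (d : R) : (forall q, f q.+1 = f q + d) ->
    (forall q, 0 <= f q <= total T) -> d = 0.
  move=> fS fb; have fE q : f q = f 0%N + q%:R * d.
    elim: q => [|q IH]; first by rewrite mul0r addr0.
    by rewrite fS IH -natr1; ring.
  apply/eqP; apply: contraT => d0.
  have d0' : 0 < `|d| by rewrite normr_gt0.
  pose q := Num.bound (total T / `|d|).
  have hq : total T / `|d| < q%:R.
    by apply: archi_boundP; rewrite divr_ge0 //; have := bnd 0; lra.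
  rewrite ltr_pdivrMr // in hq.
  have := fb q; rewrite fE; have := fb 0%N.
  by case: (ger0P d) hq => _ *; lra.
split; move=> [p [N [p0 per]]].
- pose f q := x (N + q * p)%N%:Z.
  have fS q : f q.+1 = f q + shiftw T (factor u N p).
    have -> : f q.+1 = x ((N + q * p)%N%:Z + p%:Z) by rewrite /f; congr x; lia.
    rewrite trace_factor; congr (_ + shiftw T _).
    apply: eq_map => k; rewrite -!PoszD.
    elim: q => [|q IH]; first by congr (u _%:Z); lia.
    rewrite -IH -(per (N + q * p + k)%N); last by lia.
    by congr (u _%:Z); lia.
  have /(shiftw_eq0 irr)/(congr1 size) := const f _ fS (fun q => bnd _).
  by rewrite size_mkseq /=; lia.
- pose f q := x (- (N + q * p)%N%:Z).
  have fS q : f q.+1 = f q + - shiftw T (factor u (- (N + p)%N%:Z) p).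
    have -> : f q = x (- (N + q.+1 * p)%N%:Z + p%:Z) by rewrite /f; congr x; lia.
    rewrite trace_factor -addrA; apply/esym.
    rewrite -[RHS]addr0; congr (_ + _).
    suff -> : factor u (- (N + q.+1 * p)%N%:Z) p = factor u (- (N + p)%N%:Z) p.
      exact: subrr.
    apply/eq_in_map => k; rewrite mem_iota add0n => /andP[_ kp].
    elim: q => [|q IH]; first by rewrite mul1n.
    rewrite -IH.
    have := per (N + q.+1 * p - k.+1)%N.
    have -> : - ((N + q.+1 * p - k.+1 + p).+1)%:Z = - (N + q.+2 * p)%N%:Z + k by nia.
    have -> : - ((N + q.+1 * p - k.+1).+1)%:Z = - (N + q.+1 * p)%N%:Z + k by nia.
    by apply; nia.
  have /eqP := const f _ fS (fun q => bnd _).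
  rewrite oppr_eq0 => /eqP/(shiftw_eq0 irr)/(congr1 size).
  by rewrite size_mkseq /=; lia.
Qed.

End Traces.

(** * Density of the orbits *)

Section Density.
Variables (R : realType) (T : iet R).

Lemma up_gt0 : 0 < up T.
Proof. by have [a0 b0 c0] := abc_gt0 T; rewrite /up; lra. Qed.

Lemma down_gt0 : 0 < down T.
Proof. by have [a0 b0 c0] := abc_gt0 T; rewrite /down; lra. Qed.

Lemma floor_remainder (w d : R) : 0 < d ->
  0 <= w - (Num.floor (w / d))%:~R * d < d.
Proof.
move=> d0; have /andP[h1 h2] := floor_itv (w / d).
rewrite ler_pdivlMr // in h1; rewrite ltr_pdivrMr // rmorphD /= in h2.
by lra.
Qed.

(** A lattice without a least positive element has arbitrarily small ones. *)
Lemma lattice_small (e : R) : irrational T -> 0 < e ->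
  exists d, lattice T d /\ 0 < d < e.
Proof.
move=> irr e0.
have half d : lattice T d -> 0 < d ->
    exists d', lattice T d' /\ 0 < d' <= d / 2%:R.
  move=> Ld d0.
  have [w [Lw wd]] : exists w, lattice T w /\
      forall i : int, w <> i%:~R * d.
    apply: contrapT => nw.
    have multiple w : lattice T w -> exists i : int, w = i%:~R * d.
      by move=> Lw; apply: contrapT => ni; apply: nw; exists w; split=> // i wi;
        apply: ni; exists i.
    have [i iE] := multiple _ (lattice_up T).
    have [j jE] := multiple _ (lattice_down T).
    have [] : j = 0 /\ i = 0 by apply: irr; rewrite iE jE; ring.
    by move=> _ i0; have := up_gt0; rewrite iE i0 mul0r ltxx.
  pose r := w - (Num.floor (w / d))%:~R * d.
  have rb : 0 <= r < d := floor_remainder w d0.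
  have Lr : lattice T r by apply: latticeB => //; apply: latticeMz.
  have r0 : r != 0.
    by apply/eqP => /subr0_eq; apply: wd.
  have [h|h] := lerP r (d / 2%:R); first by exists r; split=> //; lra.
  by exists (d - r); split; [exact: latticeB|lra].
have pow n : exists d, lattice T d /\ 0 < d <= up T / 2%:R ^+ n.
  elim: n => [|n [d [Ld /andP[d0 dn]]]].
    by exists (up T); rewrite expr0 divr1 up_gt0 /=; split; [exact: lattice_up|].
  have [d' [Ld' /andP[d'0 d'd]]] := half d Ld d0.
  exists d'; split=> //; rewrite d'0 /= (le_trans d'd) //.
  by rewrite exprSr invfM mulrA ler_pM2r // invr_gt0 ltr0n.
pose n := Num.bound (up T / e).
have hn : up T / e < 2%:R ^+ n.
  apply: (@lt_trans _ _ n%:R).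
    by apply: archi_boundP; rewrite divr_ge0 // ltW // up_gt0.
  by rewrite -natrX ltr_nat ltn_expl.
have [d [Ld /andP[d0 dn]]] := pow n.
exists d; split=> //; rewrite d0 /= (le_lt_trans dn) //.
rewrite ltr_pdivrMr ?exprn_gt0 ?ltr0n // mulrC.
by rewrite ltr_pdivrMr // in hn.
Qed.

Lemma lattice_dense (z s t : R) : irrational T -> s < t ->
  exists y, lattice T (y - z) /\ s < y < t.
Proof.
move=> irr st; have ts0 : 0 < t - s by lra.
have [d [Ld /andP[d0 dts]]] := lattice_small irr ts0.
have hb := floor_remainder (s - z) d0.
exists (z + ((Num.floor ((s - z) / d))%:~R * d + d)); split; last by lra.
by rewrite addrC addKr; apply: latticeD => //; apply: latticeMz.
Qed.

Lemma dom_lattice (z : R) : irrational T ->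
  exists y, iet_dom T y /\ lattice T (y - z).
Proof.
move=> irr; have [a0 b0 c0] := abc_gt0 T.
have h : 0 < total T by rewrite /total; lra.
by have [y [Ly yb]] := lattice_dense z irr h; exists y; split=> //;
  apply: dom_interior.
Qed.

Variables (x : int -> R) (u : biword).
Hypotheses (xu : trace T x u) (irr : irrational T).

Lemma trace_dense s t : 0 <= s -> s < t -> t <= total T ->
  exists n, s < x n < t.
Proof.
move=> s0 st tT; have [y [Ly yb]] := lattice_dense (x 0) irr st.
have [|n xn] := @trace_reaches _ _ _ _ xu y _ Ly.
  by apply: dom_interior; lra.
by exists n; rewrite xn.
Qed.

Lemma trace_dense_itv X s t : lo T X <= s -> s < t -> t <= hi T X ->
  exists n, u n = X /\ s < x n < t.
Proof.
move=> Xs st tX; have [a0 b0 c0] := abc_gt0 T.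
have [|||n xn] := @trace_dense s t => //.
- by move: Xs; rewrite /lo; case: (letterP X) => -> /=; lra.
- by move: tX; rewrite /hi /lo /len /total; case: (letterP X) => -> /=; lra.
exists n; split=> //; apply: itv_inj (xu n).1 _.
by apply: itv_interior; lra.
Qed.

End Density.

Section Words.
Variable R : realType.

Lemma is_3iet_trace u : is_3iet_word R u ->
  exists (T : iet R) (x : int -> R), trace T x u /\ irrational T.
Proof.
move=> [ap [T [x0 [x0d cod]]]].
have [x [u' [_ xu' cod']]] := trace_exists x0d.
suff uu' : u' = u.
  rewrite uu' in xu'.
  by exists T, x; split=> //; apply: aperiodic_irrational xu' ap.
apply/funext => n.
have [X nX] := dom_letter (iet_iter_dom n x0d).
by rewrite (cod _ _ nX) (cod' _ _ nX).
Qed.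

Lemma irrational_3iet (T : iet R) x0 : irrational T -> iet_dom T x0 ->
  exists x u, [/\ x 0 = x0, trace T x u & is_3iet_word R u].
Proof.
move=> irr x0d; have [x [u [x0E xu cod]]] := trace_exists x0d.
exists x, u; split=> //; split; first exact: irrational_aperiodic xu irr.
by exists T, x0.
Qed.

Definition scale (k : R) (k0 : 0 < k) (T : iet R) : iet R :=
  Iet (iet_left T) (mulr_gt0 k0 (iet_a_gt0 T)) (mulr_gt0 k0 (iet_b_gt0 T))
    (mulr_gt0 k0 (iet_c_gt0 T)).

Lemma trace_scale k (k0 : 0 < k) T x u : trace T x u ->
  trace (scale k0 T) (fun n => k * x n) u.
Proof.
move=> xu n; have [xn xS] := xu n; split.
  move: xn; rewrite !mem_itvE /=.
  have -> : lo (scale k0 T) (u n) = k * lo T (u n).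
    by rewrite /lo /=; case: ifP => _; [rewrite mulr0|case: ifP => _ //; ring].
  have -> : hi (scale k0 T) (u n) = k * hi T (u n).
    by rewrite /hi /lo /len /=; case: (letterP (u n)) => -> /=; ring.
  by rewrite !ler_pM2l // !ltr_pM2l.
by rewrite xS /shift /up /down /=; ring.
Qed.

Lemma irrational_scale k (k0 : 0 < k) T : irrational T -> irrational (scale k0 T).
Proof.
move=> irr i j; rewrite /up /down /= -!mulrDr ![_%:~R * (k * _)]mulrCA.
by move/(mulfI (lt0r_neq0 k0))/irr.
Qed.

End Words.

(** * Frequencies of the letters *)

Section Reflection.
Variable R : realType.

Definition swapAC (X : letter) : letter :=
  if X == lA then lC else if X == lB then lB else lA.

Definition reflect (T : iet R) : iet R :=
  Iet (~~ iet_left T) (iet_c_gt0 T) (iet_b_gt0 T) (iet_a_gt0 T).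

Lemma trace_reflect T x u : trace T x u ->
  trace (reflect T) (fun n => total T - x n) (swapAC \o u).
Proof.
move=> xu n; have [xn xS] := xu n; split; last first.
  rewrite xS /shift /up /down /= /swapAC.
  by case: (letterP (u n)) => -> /=; ring.
move: xn; rewrite !mem_itvE /total /= /lo /hi /lo /len /swapAC.
by case: (iet_left T) => /=; case: (letterP (u n)) => -> /=; lra.
Qed.

Lemma irrational_reflect T : irrational T -> irrational (reflect T).
Proof.
move=> irr i j; rewrite /up /down /= addrC [iet_c T + _]addrC => h.
by have [-> ->] := irr j i (esym h).
Qed.

End Reflection.

Section Rotation.
Variables (R : realType) (T : iet R) (x0 : R).
Local Notation N := (up T + down T).

Let N0 : 0 < N.
Proof. by rewrite addr_gt0 ?up_gt0 ?down_gt0. Qed.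

Definition rot (i : int) : R :=
  let w := x0 + i%:~R * up T in w - (Num.floor (w / N))%:~R * N.

Lemma rot_bounds i : 0 <= rot i < N.
Proof. exact: floor_remainder. Qed.

Lemma rot_eq i (k : int) y : 0 <= y < N ->
  y = x0 + i%:~R * up T + k%:~R * N -> rot i = y.
Proof.
move=> yb yE; have rb := rot_bounds i; apply/eqP; rewrite -subr_eq0.
have e : rot i - y = (- Num.floor ((x0 + i%:~R * up T) / N) - k)%:~R * N.
  by rewrite yE /rot rmorphB rmorphN /=; ring.
have : `|rot i - y| < N by rewrite ltr_norml; lra.
rewrite e normrM (gtr0_norm N0) -[ltRHS]mul1r ltr_pM2r // -intr_norm ltrz1 => h.
by rewrite mulf_eq0 intr_eq0; apply/orP; left; lia.
Qed.

Lemma telescope_bounded (f : int -> R) (B : R) : (forall i, `|f i| <= B) ->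
  forall m, exists C, forall r : nat, `|\sum_(i < r) (f i%:Z - f (i%:Z + m))| <= C.
Proof.
move=> fB.
have one m (r : nat) :
    `|\sum_(i < r) (f (i%:Z + m) - f (i%:Z + (m + 1)))| <= B + B.
  have -> : \sum_(i < r) (f (i%:Z + m) - f (i%:Z + (m + 1))) =
      f m - f (r%:Z + m).
    elim: r => [|r IH]; first by rewrite big_ord0 add0r subrr.
    rewrite big_ord_recr /= IH addrA subrK.
    by have -> : r%:Z + (m + 1) = r.+1%:Z + m by lia.
  by rewrite (le_trans (ler_normB _ _)) // lerD.
have split m (r : nat) : \sum_(i < r) (f i%:Z - f (i%:Z + (m + 1))) =
    \sum_(i < r) (f i%:Z - f (i%:Z + m)) +
    \sum_(i < r) (f (i%:Z + m) - f (i%:Z + (m + 1))).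
  by rewrite -big_split; apply: eq_bigr => i _ /=; ring.
apply: int_step_ind.
  exists 0 => r; rewrite big1 ?normr0 // => i _.
  by rewrite addr0 subrr.
move=> m; split=> [[C h]|[C h]]; exists (C + (B + B)) => r.
  by rewrite split (le_trans (ler_normD _ _)) // lerD.
have -> := canRL (addrK _) (esym (split m r)).
by rewrite (le_trans (ler_normB _ _)) // lerD.
Qed.

(** An arc whose length [b'] lies in the lattice has bounded discrepancy:
    rotating by [b'] is an iterate of the rotation, so that the indicator of the
    arc differs from its mean by a coboundary. *)
Lemma rot_discrepancy b' : lattice T b' -> 0 < b' < N ->
  exists C, forall r : nat,
    `|N * (\sum_(i < r) (N - b' <= rot i%:Z)%R%:R) - r%:R * b'| <= C.
Proof.
move=> [k [l kl]] b'b.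
have rotB i : `|rot i| <= N by have := rot_bounds i; rewrite ler_norml; lra.
have [C CP] := telescope_bounded rotB (k - l).
exists C => r; apply: le_trans (CP r); rewrite le_eqVlt; apply/orP; left.
have -> : r%:R * b' = \sum_(i < r) b' by rewrite sumr_const card_ord mulr_natl.
apply/eqP; congr `|_|; rewrite mulr_sumr -sumrB; apply: eq_bigr => i _.
have rb := rot_bounds i.
have rE : rot i = x0 + i%:~R * up T +
  (- Num.floor ((x0 + i%:Z%:~R * up T) / N))%:~R * N.
  by rewrite /rot rmorphN /=; ring.
set f := - Num.floor _ in rE.
have [h|h] := lerP (N - b') (rot i).
  rewrite (@rot_eq (i%:Z + (k - l)) (f - 1 + l) (rot i + b' - N)); [rewrite mulr1; ring|lra|].
  by rewrite rE kl !(rmorphD, rmorphN) /=; ring.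
rewrite (@rot_eq (i%:Z + (k - l)) (f + l) (rot i + b')); [rewrite mulr0; ring|lra|].
by rewrite rE kl !(rmorphD, rmorphN) /=; ring.
Qed.

End Rotation.

Section Frequency.
Variable R : realType.

Lemma factorS (u : biword) i n : factor u i n.+1 = rcons (factor u i n) (u (i + n%:Z)).
Proof. exact: mkseqS. Qed.

(** The letters [lB] record the visits of the rotation to the arc of length [b]
    outside of the domain of [T], which is compared with arcs of lattice
    lengths close to [b]. *)
Lemma frequencyB_left (T : iet R) x u : iet_left T -> trace T x u ->
  irrational T -> forall e : R, 0 < e -> exists C, forall n : nat,
  let nB := count_mem lB (factor u 0 n) in
  `|(up T + down T) * nB%:R - (n + nB)%N%:R * iet_b T| <= e * n%:R + C.
Proof.
move=> Tl xu irr e e0; have [a0 b0 c0] := abc_gt0 T.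
set N := up T + down T; pose nB n := count_mem lB (factor u 0 n).
have nBS n : nB n.+1 = (nB n + (u n%:Z == lB))%N.
  by rewrite /nB factorS -cats1 count_cat add0r /= addn0.
have nBn n : (nB n <= n)%N by rewrite /nB -[leqRHS](size_mkseq (fun k => u (0 + k%:Z))) count_size.
have xb n := (mem_domE T _).1 (trace_dom xu n); rewrite Tl in xb.
have tN : N - iet_b T = total T by rewrite /N /up /down /total; ring.
pose z := rot T (x 0).
(* Between [x n] and [x (n + 1)] the rotation takes two steps if [u n] is lB,
   the first one leaving the domain of [T], and one step otherwise. *)
have zx (n : nat) : z (n + nB n)%N%:Z = x n.
  have := trace_factor xu 0 n; rewrite add0r => xn.
  pose o := ones (factor u 0 n).
  apply: (@rot_eq _ _ _ _ (- o%:Z)); first by have := xb n; rewrite -/N; lra.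
  rewrite xn shiftwE -/o -addrA; congr (_ + _).
  set m := count _ _.
  have mo : (n + nB n = m + o)%N.
    have [h1 h2 h3] := count_letters (factor u 0 n).
    by rewrite /m h2 /o h3 -/(nB n); rewrite size_mkseq -/(nB n) in h1; lia.
  by rewrite mo rmorphN /= -!pmulrn natrD /N; ring.
have zB n : \sum_(i < (n + nB n)%N) (total T <= z i%:Z)%R%:R = (nB n)%:R :> R.
  elim: n => [|n IH]; first by rewrite big_ord0.
  rewrite nBS; have [uB|uB] := eqVneq (u n%:Z) lB; last first.
    rewrite addn0 addSn big_ord_recr /= IH zx.
    by have := xb n; case: lerP; rewrite ?addr0 //; lra.
  rewrite addn1 addnS addSn !big_ord_recr /= IH zx.
  have -> : total T <= x n = false by have := xb n; lra.
  suff -> : total T <= z (n + nB n).+1%:Z by rewrite addr0 natr1.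
  rewrite /z (@rot_eq _ _ _ _ (Num.floor ((x 0 + (n + nB n)%N%:Z%:~R * up T) / N) * (-1)) (x n + up T)).
  - have := (xu n).1; rewrite uB mem_itvE Tl /lo /hi /lo /len /total /up /=; lra.
  - have := (xu n).1; rewrite uB mem_itvE Tl /lo /hi /lo /len /up /down /=; lra.
  - rewrite -zx /z /rot -/N -addn1 PoszD rmorphD rmorphM /=; ring.
have [b1 [Lb1 b1b]] : exists b1, lattice T b1 /\
    Num.max 0 (iet_b T - e / 2%:R) < b1 < iet_b T.
  have h : Num.max 0 (iet_b T - e / 2%:R) < iet_b T by rewrite gt_max; lra.
  by have [y [Ly yb]] := lattice_dense 0 irr h; exists y; rewrite subr0 in Ly.
have [b2 [Lb2 b2b]] : exists b2, lattice T b2 /\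
    iet_b T < b2 < Num.min N (iet_b T + e / 2%:R).
  have h : iet_b T < Num.min N (iet_b T + e / 2%:R).
    by rewrite lt_min /N /up /down; lra.
  by have [y [Ly yb]] := lattice_dense 0 irr h; exists y; rewrite subr0 in Ly.
rewrite gt_max in b1b; rewrite lt_min in b2b.
have [C1 C1P] := @rot_discrepancy _ T (x 0) b1 Lb1 ltac:(rewrite -/N; lra).
have [C2 C2P] := @rot_discrepancy _ T (x 0) b2 Lb2 ltac:(rewrite -/N; lra).
exists (C1 + C2) => n /=; rewrite -/(nB n); set r := (n + nB n)%N.
have mono (p q : R) : p <= q ->
    \sum_(i < r) (N - p <= z i%:Z)%R%:R <= \sum_(i < r) (N - q <= z i%:Z)%R%:R :> R.
  move=> pq; apply: ler_sum => i _; rewrite ler_nat.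
  by case: (lerP (N - p)) => // h; case: lerP => //; lra.
have m1 := mono b1 (iet_b T) ltac:(lra).
have m2 := mono (iet_b T) b2 ltac:(lra).
rewrite tN zB in m1 m2.
have N0 : 0 < N by rewrite addr_gt0 ?up_gt0 ?down_gt0.
rewrite -(ler_pM2l N0) in m1; rewrite -(ler_pM2l N0) in m2.
have := C1P r; have := C2P r; rewrite -/N -/z !ler_norml.
have rn : r%:R <= 2%:R * n%:R :> R.
  by rewrite -natrM ler_nat /r mul2n -addnn leq_add2l.
have r0 : 0 <= r%:R :> R by [].
move: m1 m2; set S1 := \sum_(i < r) _; set S2 := \sum_(i < r) _ => m1 m2 h2 h1.
have k1 : r%:R * (iet_b T - b1) <= r%:R * (e / 2%:R) by rewrite ler_wpM2l //; lra.
have k2 : r%:R * (b2 - iet_b T) <= r%:R * (e / 2%:R) by rewrite ler_wpM2l //; lra.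
have k3 : r%:R * (e / 2%:R) <= 2%:R * n%:R * (e / 2%:R) by rewrite ler_wpM2r //; lra.
have C10 : 0 <= C1 by lra.
have C20 : 0 <= C2 by lra.
apply/andP; split; lra.
Qed.

Lemma frequencyB (T : iet R) x u : trace T x u ->
  irrational T -> forall e : R, 0 < e -> exists C, forall n : nat,
  let nB := count_mem lB (factor u 0 n) in
  `|(up T + down T) * nB%:R - (n + nB)%N%:R * iet_b T| <= e * n%:R + C.
Proof.
move=> xu irr e e0; have [Tl|Tl] := boolP (iet_left T).
  exact: frequencyB_left Tl xu irr e e0.
have [C CP] := @frequencyB_left (reflect T) _ _ Tl (trace_reflect xu)
  (irrational_reflect irr) e e0.
exists C => n; have := CP n.
have -> : count_mem lB (factor (swapAC \o u) 0 n) = count_mem lB (factor u 0 n).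
  rewrite !count_map; apply: eq_count => k /=; rewrite /swapAC.
  by case: (letterP (u (0 + k%:Z))) => ->.
suff -> : up (reflect T) + down (reflect T) = up T + down T by [].
by rewrite /up /down /=; ring.
Qed.

Lemma frequency (T : iet R) x u : trace T x u ->
  irrational T -> forall e : R, 0 < e -> exists C, forall (n : nat) X,
  `|total T * (count_mem X (factor u 0 n))%:R - n%:R * len T X| <= e * n%:R + C.
Proof.
move=> xu irr e e0; have [a0 b0 c0] := abc_gt0 T.
set N := up T + down T.
have N0 : 0 < N by rewrite addr_gt0 ?up_gt0 ?down_gt0.
have q0 : 0 < total T by rewrite /total; lra.
have [C CP] := frequencyB xu irr e0.
exists (C + total T) => n X.
have := CP n; rewrite /=.
pose w := factor u 0 n.
pose nA := (count_mem lA w)%:R : R; pose nB := (count_mem lB w)%:R : R.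
pose nC := (count_mem lC w)%:R : R.
have nE : n%:R = nA + nB + nC.
  have [h _ _] := count_letters w.
  by rewrite /nA /nB /nC -!natrD -h size_mkseq.
have xb : `|(nA + nB) * up T - (nB + nC) * down T| <= total T.
  have := trace_factor xu 0 n; rewrite add0r shiftwE -/w.
  have [_ -> ->] := count_letters w; rewrite !natrD.
  have := (mem_domE T _).1 (trace_dom xu 0).
  have := (mem_domE T _).1 (trace_dom xu n).
  by rewrite ler_norml; case: (iet_left T) => *; lra.
rewrite -/w -/N natrD -/nB nE => hB.
have tot : total T = N - iet_b T by rewrite /total /N /up /down; ring.
have qB : `|total T * nB - (nA + nB + nC) * iet_b T| <= e * (nA + nB + nC) + C.
  apply: le_trans hB; rewrite tot le_eqVlt; apply/orP; left; apply/eqP.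
  by congr `|_|; ring.
have qN : total T <= N by lra.
(* [d] is the displacement of the orbit and [E] the error on the letter lB. *)
have scaled (s v d E : R) : N * v = total T * d - E * s -> 0 <= s <= N ->
    `|d| <= total T -> `|E| <= e * (nA + nB + nC) + C ->
    `|v| <= e * (nA + nB + nC) + (C + total T).
  move=> vE sN dq EC; rewrite -(ler_pM2l N0) -{1}(gtr0_norm N0) -normrM vE.
  rewrite (le_trans (ler_normB _ _)) // !normrM (gtr0_norm q0).
  rewrite (ger0_norm (_ : 0 <= s)); last by lra.
  have h1 : total T * `|d| <= N * total T by rewrite ler_pM //; lra.
  have h2 : `|E| * s <= (e * (nA + nB + nC) + C) * N by rewrite ler_pM //; lra.
  by lra.
have [uN dN] : 0 <= up T <= N /\ 0 <= down T <= N.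
  by have := up_gt0 T; have := down_gt0 T; rewrite /N; lra.
have xb' : `|- ((nA + nB) * up T - (nB + nC) * down T)| <= total T.
  by rewrite normrN.
case: (letterP X) => ->; rewrite -/w -/nA -/nB -/nC /len /=.
- apply: (scaled _ _ _ _ _ uN xb qB).
  rewrite /N /total /up /down. ring.
- by apply: le_trans qB _; lra.
- apply: (scaled _ _ _ _ _ dN xb' qB).
  rewrite /N /total /up /down. ring.
Qed.

End Frequency.

(** * The image of a coding under a morphism *)

Section Image.
Variables (phi : seq letter -> seq letter).
Hypothesis phi_morphism : is_morphism phi.

Lemma phi_cat s t : phi (s ++ t) = phi s ++ phi t.
Proof. exact: phi_morphism.2. Qed.

Lemma count_phi (P : pred letter) w :
  count P (phi w) = (\sum_X count_mem X w * count P (phi [:: X]))%N.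
Proof.
elim: w => [|Y w IH]; first by rewrite phi_morphism.1 big1.
rewrite -cat1s phi_cat count_cat IH [RHS](eq_bigr (fun X =>
  ((X == Y) * count P (phi [:: X]) + count_mem X w * count P (phi [:: X]))%N)).
  rewrite big_split /=; congr addn; rewrite (bigD1 Y) //= eqxx mul1n big1 ?addn0 //.
  by move=> X /negbTE ->.
by move=> X _; rewrite count_cat /= addn0 mulnDl eq_sym.
Qed.

Lemma size_phi w :
  size (phi w) = (\sum_X count_mem X w * size (phi [:: X]))%N.
Proof. by rewrite -!count_predT count_phi; under eq_bigr do rewrite count_predT. Qed.

Lemma factor_cat (u : biword) i m n :
  factor u i (m + n) = factor u i m ++ factor u (i + m%:Z) n.
Proof.
rewrite /factor /mkseq iotaD map_cat add0n; congr (_ ++ _).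
rewrite -[in LHS](addn0 m) iotaDl -map_comp; apply: eq_map => k /=.
by rewrite PoszD addrA.
Qed.

Lemma factor1 (u : biword) i : factor u i 1 = [:: u i].
Proof. by rewrite /factor /mkseq /= addr0. Qed.

Variables (u v : biword).
Hypothesis uv : is_image phi u v.

(** The position in the image at which the block of the letter [u n] begins. *)
Definition pos : int -> int := prim (fun m => (size (phi [:: u m]))%:Z).

Lemma pos_right (n : nat) : pos n = (size (phi (factor u 0 n)))%:Z.
Proof.
elim: n => [|n IH]; first by rewrite /pos prim0 phi_morphism.1.
rewrite -addn1 PoszD /pos primS -/(pos n) IH factor_cat phi_cat size_cat PoszD.
by rewrite factor1 add0r.
Qed.

Lemma pos_left (n : nat) : pos (- n%:Z) = - (size (phi (factor u (- n%:Z) n)))%:Z.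
Proof.
elim: n => [|n IH]; first by rewrite oppr0 /pos prim0 phi_morphism.1.
have e : - n%:Z = - n.+1%:Z + 1 by lia.
move: IH; rewrite {1}e /pos primS -/(pos _) => /(canRL (addrK _)) ->.
have -> : factor u (- n.+1%:Z) n.+1 = [:: u (- n.+1%:Z)] ++ factor u (- n%:Z) n.
  by rewrite e -factor1 -factor_cat.
by rewrite phi_cat size_cat PoszD opprD addrC.
Qed.

Lemma image_block n : factor v (pos n) (size (phi [:: u n])) = phi [:: u n].
Proof.
have [vr vl _ _] := uv; case: n => k.
  have := vr k.+1; rewrite /= -addn1 factor_cat phi_cat size_cat factor_cat.
  rewrite add0r -pos_right => /eqP; rewrite eqseq_cat ?size_mkseq // => /andP[_].
  by rewrite factor1 add0r => /eqP.
have := vl k.+1; rewrite /= -pos_left -(addn1 k) (addnC k) factor_cat.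
rewrite phi_cat size_cat factor_cat => /eqP; rewrite eqseq_cat; last first.
  by rewrite size_mkseq factor1.
by rewrite factor1 -NegzE => /andP[/eqP].
Qed.

Lemma image_at n j : (j < size (phi [:: u n]))%N ->
  v (pos n + j%:Z) = nth lA (phi [:: u n]) j.
Proof. by move=> jn; rewrite -[in RHS]image_block nth_mkseq. Qed.

Lemma image_cover m : exists n j,
  (j < size (phi [:: u n]))%N /\ m = pos n + j%:Z.
Proof.
have [_ _ hr hl] := uv.
have [n1 h1] := hr `|m|.+1%N; have [n2 h2] := hl `|m|.+1%N.
have [|||k kP] := @int_crossing pos m (- n2%:Z) n1%:Z; rewrite ?pos_right ?pos_left;
  try by lia.
rewrite /pos primS -/(pos k) in kP.
by exists k, `|m - pos k|%N; split; lia.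
Qed.

Lemma trace_block (R : realType) (T : iet R) y n j : trace T y v ->
  (j <= size (phi [:: u n]))%N ->
  y (pos n + j%:Z) = y (pos n) + shiftw T (take j (phi [:: u n])).
Proof.
move=> yv jn; rewrite (trace_factor yv); congr (_ + shiftw T _).
rewrite -[in RHS]image_block /factor /mkseq -map_take take_iota.
by move/minn_idPl: jn => ->.
Qed.

Lemma phi_nonerasing_letter : exists X, phi [:: X] != [::].
Proof.
by have [n [j [jn _]]] := image_cover 0; exists (u n); case: phi jn.
Qed.

End Image.

Section ImageLengths.
Variables (R : realType) (phi : seq letter -> seq letter).
Hypothesis phi_morphism : is_morphism phi.

(** The row vector of the lengths of [T] times the incidence matrix. *)
Definition imlen (T : iet R) (Y : letter) : R :=
  \sum_X len T X * (count_mem Y (phi [:: X]))%:R.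

Lemma linear_bound (K : R) : 0 <= K ->
  (forall e : R, 0 < e -> exists C, forall n : nat, K * n%:R <= e * n%:R + C) -> K = 0.
Proof.
move=> K0 H; apply/eqP; apply: contraT => Kn0.
have {Kn0}K0 : 0 < K by rewrite lt0r Kn0.
have [C CP] := H (K / 2%:R) ltac:(lra).
have h := archi_boundP (_ : 0 <= `|C| / (K / 2%:R)).
have {}h := h ltac:(by rewrite divr_ge0 //; lra).
rewrite ltr_pdivrMr in h; last by lra.
by have := CP (Num.bound (`|C| / (K / 2%:R))); have := ler_norm C; lra.
Qed.

(** The letters of the image of a long prefix of [u] can be counted from the
    frequencies of [u] or from those of [v]. *)
Lemma image_proportional (T T' : iet R) x y u v : is_image phi u v ->
  trace T x u -> irrational T -> trace T' y v -> irrational T' ->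
  forall Y, total T' * imlen T Y =
    len T' Y * \sum_X len T X * (size (phi [:: X]))%:R.
Proof.
move=> uv xu irr yv irr' Y.
pose g X : R := total T' * (count_mem Y (phi [:: X]))%:R -
  (size (phi [:: X]))%:R * len T' Y.
pose K := \sum_X len T X * g X.
have [a0 b0 c0] := abc_gt0 T.
have q0 : 0 < total T by rewrite /total; lra.
suff : `|K| = 0.
  move/normr0_eq0 => K0; apply/subr0_eq; rewrite -[RHS]K0 /imlen /K.
  rewrite !mulr_sumr -sumrB; apply: eq_bigr => X _.
  by rewrite /g; ring.
apply: linear_bound => // e e0.
pose H : R := (\sum_X size (phi [:: X]))%N%:R.
pose G := \sum_X `|g X|.
have H0 : 0 <= H by [].
have G0 : 0 <= G by apply: sumr_ge0.
pose D := total T * H + G + 1.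
have D0 : 0 < D by rewrite /D ltr_pwDr // addr_ge0 // mulr_ge0 // ltW.
have eD : 0 < e / D by rewrite divr_gt0.
have [C CP] := frequency xu irr eD.
have [C' CP'] := frequency yv irr' eD.
exists (total T * C' + G * C) => n.
pose w := factor u 0 n.
have mH : (size (phi w))%:R <= H * n%:R.
  rewrite -natrM ler_nat size_phi // big_distrl /=; apply: leq_sum => X _.
  by rewrite mulnC leq_mul2l -[leqRHS](size_mkseq (fun k => u (0 + k%:Z))) count_size orbT.
have := CP' (size (phi w)) Y; have [vr _ _ _] := uv; rewrite vr.
pose S := \sum_X (count_mem X w)%:R * g X.
have -> : total T' * (count_mem Y (phi w))%:R - (size (phi w))%:R * len T' Y = S.
  rewrite (count_phi phi_morphism) (size_phi phi_morphism) !natr_sum mulr_sumr mulr_suml -sumrB.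
  by apply: eq_bigr => X _; rewrite !natrM /g; ring.
move=> SC.
pose E X := total T * (count_mem X w)%:R - n%:R * len T X.
have KE : K * n%:R = total T * S - \sum_X E X * g X.
  rewrite /K /S mulr_sumr mulr_suml -sumrB; apply: eq_bigr => X _.
  by rewrite /E; ring.
have Eg : `|\sum_X E X * g X| <= (e / D * n%:R + C) * G.
  rewrite (le_trans (ler_norm_sum _ _ _)) // mulr_sumr; apply: ler_sum => X _.
  by rewrite normrM ler_wpM2r // CP.
have -> : `|K| * n%:R = `|total T * S - \sum_X E X * g X|.
  by rewrite -KE normrM normr_nat.
rewrite (le_trans (ler_normB _ _)) // normrM (gtr0_norm q0).
have h1 : total T * `|S| <= total T * (e / D * (size (phi w))%:R + C').
  by rewrite ler_pM2l.
have h2 : total T * (e / D) * (size (phi w))%:R <= total T * (e / D) * (H * n%:R).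
  by rewrite ler_pM2l // mulr_gt0.
have h3 : e * n%:R = e / D * D * n%:R by rewrite divfK // lt0r_neq0.
have h4 : 0 <= e / D * n%:R by rewrite mulr_ge0 // ltW.
by move: h3; rewrite /D; lra.
Qed.

(** Rescaling makes the lengths of an image equal to those given by the incidence
    matrix. *)
Lemma image_trace (T : iet R) x u v : is_image phi u v ->
  trace T x u -> irrational T -> is_3iet_word R v ->
  exists (T' : iet R) y,
    [/\ trace T' y v, irrational T' & forall Y, len T' Y = imlen T Y].
Proof.
move=> uv xu irr /is_3iet_trace[T'' [y'' [yv irr'']]].
have prop := image_proportional uv xu irr yv irr''.
set S := \sum_X len T X * (size (phi [:: X]))%:R in prop.
have [a0 b0 c0] := abc_gt0 T; have [a0' b0' c0'] := abc_gt0 T''.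
have len0 X : 0 < len T X by rewrite /len; case: (letterP X) => ->.
have S0 : 0 < S.
  have [Z Zn] := phi_nonerasing_letter phi_morphism uv.
  rewrite /S (bigD1 Z) //= ltr_pwDl //.
    by rewrite mulr_gt0 // ltr0n lt0n size_eq0.
  by apply: sumr_ge0 => X _; rewrite mulr_ge0 // ltW.
have q0 : 0 < total T'' by rewrite /total; lra.
have k0 : 0 < S / total T'' by rewrite divr_gt0.
exists (scale k0 T''), (fun n => S / total T'' * y'' n); split.
- exact: trace_scale.
- exact: irrational_scale.
move=> Y; have -> : len (scale k0 T'') Y = S / total T'' * len T'' Y.
  by rewrite /len /=; case: (letterP Y) => ->.
by apply: (mulfI (lt0r_neq0 q0)); rewrite prop; field; apply: lt0r_neq0.
Qed.

Lemma up_image (T T' : iet R) : (forall Y, len T' Y = imlen T Y) ->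
  up T' = \sum_X len T X * (ones (phi [:: X]))%:R.
Proof.
move=> TT'; have -> : up T' = len T' lB + len T' lC by [].
rewrite !TT' /imlen -big_split; apply: eq_bigr => X _ /=.
by have [_ _ ->] := count_letters (phi [:: X]); rewrite natrD mulrDr.
Qed.

Lemma down_image (T T' : iet R) : (forall Y, len T' Y = imlen T Y) ->
  down T' = \sum_X len T X * (zeros (phi [:: X]))%:R.
Proof.
move=> TT'; have -> : down T' = len T' lA + len T' lB by [].
rewrite !TT' /imlen -big_split; apply: eq_bigr => X _ /=.
by have [_ -> _] := count_letters (phi [:: X]); rewrite natrD mulrDr.
Qed.

End ImageLengths.

(** * Exchanges with independent lengths *)

Lemma sqr_odd_logn (n m q p : nat) : odd (logn p q) ->
  (n ^ 2 = q * m ^ 2)%N -> m = 0%N.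
Proof.
move=> oq nm; apply/eqP; apply: contraT; rewrite -lt0n => m0.
have q0 : (0 < q)%N by case: q oq {nm} => //; rewrite logn0.
have := congr1 (fun k => odd (logn p k)) nm.
rewrite /= lognM // ?expn_gt0 ?m0 // !lognX oddD !oddM oq.
by [].
Qed.

Section Square_roots.
Variable R : realType.

Lemma intr_sqr_odd_logn (x y : int) (q p : nat) : odd (logn p q) ->
  x%:~R ^+ 2 = q%:R * y%:~R ^+ 2 :> R -> y = 0.
Proof.
move=> oq xy; apply/eqP; rewrite -absz_eq0; apply/eqP.
apply: (@sqr_odd_logn `|x|%N _ q p) => //.
have : (x ^+ 2)%:~R = (q%:Z * y ^+ 2)%:~R :> R.
  by rewrite rmorphXn /= [in RHS]rmorphM /= rmorphXn /= -pmulrn.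
by move/intr_inj/(congr1 absz); rewrite abszM !abszX.
Qed.

Local Notation sqrt2 := (Num.sqrt 2%:R : R).
Local Notation sqrt3 := (Num.sqrt 3%:R : R).

Lemma sqrt2_sqrt3_free (x y z : int) :
  x%:~R + y%:~R * sqrt2 + z%:~R * sqrt3 = 0 -> [/\ x = 0, y = 0 & z = 0].
Proof.
move=> h.
have s2 : sqrt2 ^+ 2 = 2%:R by rewrite sqr_sqrtr.
have s3 : sqrt3 ^+ 2 = 3%:R by rewrite sqr_sqrtr.
have zE : z%:~R * sqrt3 = - (x%:~R + y%:~R * sqrt2) by lra.
have h2 : (2 * x * y)%:~R * sqrt2 = (3 * z ^+ 2 - x ^+ 2 - 2 * y ^+ 2)%:~R.
  have := congr1 (fun t => t ^+ 2) zE.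
  rewrite sqrrN exprMn s3 sqrrD exprMn s2.
  by rewrite !(rmorphB, rmorphM, rmorphXn) /= => h2; lra.
have /eqP : 2 * x * y = 0.
  apply: (@intr_sqr_odd_logn (3 * z ^+ 2 - x ^+ 2 - 2 * y ^+ 2) _ 2 2) => //.
  by rewrite -h2 exprMn s2 mulrC.
rewrite mulf_eq0 => /orP[/eqP x0|/eqP y0].
  have {}x0 : x = 0 by lia.
  have y0 : y = 0.
    apply: (@intr_sqr_odd_logn (3 * z) _ 6 2) => //.
    have := congr1 (fun t => t ^+ 2) zE.
    rewrite x0 add0r sqrrN exprMn s3 exprMn s2 rmorphM /= => e.
    by rewrite exprMn; lra.
  have z0 : z = 0.
    apply: (@intr_sqr_odd_logn x _ 3 3) => //.
    have := congr1 (fun t => t ^+ 2) zE.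
    by rewrite y0 mul0r addr0 sqrrN exprMn s3 mulrC => <-.
  by split.
have z0 : z = 0.
  apply: (@intr_sqr_odd_logn x _ 3 3) => //.
  have := congr1 (fun t => t ^+ 2) zE.
  by rewrite y0 mul0r addr0 sqrrN exprMn s3 mulrC => <-.
split=> //; move: h; rewrite y0 z0 !mul0r !addr0 => /eqP.
by rewrite intr_eq0 => /eqP.
Qed.

Lemma sqrt2_bounds : 1 < sqrt2 < 2%:R.
Proof.
have s2 : sqrt2 ^+ 2 = 2%:R by rewrite sqr_sqrtr.
have p2 : 0 <= sqrt2 by rewrite sqrtr_ge0.
by apply/andP; split; rewrite ltNge; apply/negP => h; nra.
Qed.

Lemma sqrt3_bounds : 1 < sqrt3 < 2%:R.
Proof.
have s3 : sqrt3 ^+ 2 = 3%:R by rewrite sqr_sqrtr.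
have p3 : 0 <= sqrt3 by rewrite sqrtr_ge0.
by apply/andP; split; rewrite ltNge; apply/negP => h; nra.
Qed.

(** As [b] varies, these exchanges are all induced by the same rotation. *)
Lemma iet_sqrt2 (b : R) : 0 < b < 1 -> exists T : iet R,
  [/\ iet_left T, iet_b T = b, up T = 1, down T = sqrt2 & irrational T].
Proof.
move=> b01; have s2 := sqrt2_bounds.
have a0 : 0 < sqrt2 - b by lra.
have b0 : 0 < b by lra.
have c0 : 0 < 1 - b by lra.
exists (Iet true a0 b0 c0); rewrite /up /down /=.
split=> //; [ring|ring|move=> i j; rewrite /up /down /= => h].
have [|i0 j0 _] := @sqrt2_sqrt3_free i (- j) 0; last by lia.
by rewrite rmorphN /= mul0r; lra.
Qed.

Lemma iet_free : exists T : iet R, [/\ iet_left T, irrational T &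
  forall i : int, lattice T (i%:~R * iet_b T) -> i = 0].
Proof.
have s3 := sqrt3_bounds.
have [|T [Tl Tb Tu Td irr]] := @iet_sqrt2 (sqrt3 - 1); first by lra.
exists T; split=> // i [j [k]]; rewrite Tb Tu Td => h.
have [|_ _ ->] := @sqrt2_sqrt3_free (- (i + j)) (- k) i; last by [].
by rewrite !(rmorphD, rmorphN) /=; lra.
Qed.

End Square_roots.

(** Along a segment in a nonzero integer direction [(e1, e2)], the ratio of the
    coordinates either is constant, hence equal to [e1 / e2], or takes an interval
    of values. It is rational somewhere in both cases. *)
Lemma irrational_segment (R : realType) (g1 g2 : R) (e1 e2 : int) :
  (forall b : R, 0 < b < 1 ->
    [/\ 0 < g1 - b * e1%:~R, 0 < g2 - b * e2%:~R & forall i j : int,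
    i%:~R * (g1 - b * e1%:~R) = j%:~R * (g2 - b * e2%:~R) -> i = 0 /\ j = 0]) ->
  e1 = 0 /\ e2 = 0.
Proof.
move=> H.
have [ge|ge] := eqVneq (g1 * e2%:~R) (g2 * e1%:~R).
  have [_ _ /(_ e2 e1)] := H (1 / 2%:R) ltac:(lra).
  by case=> //; lra.
exfalso.
pose w1 b := g1 - b * e1%:~R; pose w2 b := g2 - b * e2%:~R.
pose s : R := 1 / 3%:R; pose t : R := 2%:R / 3%:R.
have [s1 s2 _] := H s ltac:(rewrite /s; lra).
have [t1 t2 _] := H t ltac:(rewrite /t; lra).
rewrite -/(w1 s) in s1; rewrite -/(w2 s) in s2.
rewrite -/(w1 t) in t1; rewrite -/(w2 t) in t2.
have root (q : rat) : (w1 s - ratr q * w2 s) * (w1 t - ratr q * w2 t) < 0 -> False.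
  have dE : (denq q)%:~R != 0 :> R by rewrite intr_eq0 denq_neq0.
  pose f b := w1 b - ratr q * w2 b => fst.
  rewrite -/(f s) -/(f t) in fst.
  have fne : f t - f s != 0 by apply/eqP => e; nra.
  pose b := (s * f t - t * f s) / (f t - f s).
  have fb : f b = 0.
    suff : (f t - f s) * f b = 0.
      by move/eqP; rewrite mulf_eq0 (negbTE fne) => /eqP.
    have bE : (f t - f s) * b = s * f t - t * f s by rewrite mulrC divfK.
    have fE c : f c = (g1 - ratr q * g2) - c * (e1%:~R - ratr q * e2%:~R).
      by rewrite /f /w1 /w2; ring.
    rewrite [f b]fE mulrBr mulrA bE !fE; ring.
  have b01 : 0 < b < 1.
    have bE : (f t - f s) * b = s * f t - t * f s by rewrite mulrC divfK.
    rewrite /s /t in bE; apply/andP; split; rewrite ltNge; apply/negP => hb; nra.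
  have [_ _ /(_ (denq q) (numq q))] := H b b01.
  case; last by move/eqP; rewrite (negbTE (denq_neq0 q)).
  move: fb; rewrite /f -/(w1 b) -/(w2 b) /ratr => /subr0_eq ->.
  by rewrite mulrA [X in X * _]mulrC divfK.
have [h|h|h] := ltgtP (w1 s / w2 s) (w1 t / w2 t).
- have [q] := rat_in_itvoo h; rewrite in_itv /= ltr_pdivrMr // ltr_pdivlMr //.
  by move=> qb; apply: (root q); nra.
- have [q] := rat_in_itvoo h; rewrite in_itv /= ltr_pdivrMr // ltr_pdivlMr //.
  by move=> qb; apply: (root q); nra.
- move: h => /eqP; rewrite eqr_div ?lt0r_neq0 // => /eqP h.
  by move/eqP: ge; apply; move: h; rewrite /w1 /w2 /s /t; lra.
Qed.

(** * The incidence matrix *)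

Lemma det_mx33 (R : comNzRingType) (A : 'M[R]_3) : \det A =
  A lA lA * (A lB lB * A lC lC - A lB lC * A lC lB)
  - A lA lB * (A lB lA * A lC lC - A lB lC * A lC lA)
  + A lA lC * (A lB lA * A lC lB - A lB lB * A lC lA).
Proof.
pose f i j := A (inord i) (inord j).
have fE i j : A i j = f i j by rewrite /f !inord_val.
rewrite (expand_det_row _ ord0) !big_ord_recl big_ord0 /cofactor.
rewrite !(expand_det_row _ ord0) !big_ord_recl !big_ord0 /cofactor.
by rewrite !det_mx11 !mxE !fE /= /bump /=; ring.
Qed.

Section Incidence.
Variables (R : realType) (phi : seq letter -> seq letter).
Hypotheses (phi_morphism : is_morphism phi) (phi_3iet : preserves_3iet R phi).

Lemma image_exists (T : iet R) x0 : irrational T -> iet_dom T x0 ->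
  exists (x : int -> R) u v (T' : iet R) y,
    [/\ x 0 = x0, trace T x u, is_image phi u v, trace T' y v &
        irrational T' /\ forall Y, len T' Y = imlen phi T Y].
Proof.
move=> irr x0d; have [x [u [xE xu u3]]] := irrational_3iet irr x0d.
have [v uv v3] := phi_3iet u3.
have [T' [y [yv irr' TT']]] := image_trace phi_morphism uv xu irr v3.
by exists x, u, v, T', y.
Qed.

Definition zero_count X : int := (zeros (phi [:: X]))%:Z.
Definition one_count X : int := (ones (phi [:: X]))%:Z.
Local Notation z := zero_count.
Local Notation o := one_count.

Lemma up_imageE (T T' : iet R) : (forall Y, len T' Y = imlen phi T Y) ->
  up T' = down T * (o lA)%:~R + up T * (o lC)%:~R
    - iet_b T * (o lA + o lC - o lB)%:~R.
Proof.
move=> /up_image ->; rewrite sum_letter /len /= /up /down /one_count.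
by rewrite !(rmorphD, rmorphN) /= -!pmulrn; ring.
Qed.

Lemma down_imageE (T T' : iet R) : (forall Y, len T' Y = imlen phi T Y) ->
  down T' = down T * (z lA)%:~R + up T * (z lC)%:~R
    - iet_b T * (z lA + z lC - z lB)%:~R.
Proof.
move=> /down_image ->; rewrite sum_letter /len /= /up /down /zero_count.
by rewrite !(rmorphD, rmorphN) /= -!pmulrn; ring.
Qed.

(** Vary [b] while the rotation of which [T] is an induced map stays the same. *)
Lemma counts_additive : z lB = z lA + z lC /\ o lB = o lA + o lC.
Proof.
have [] := @irrational_segment R
  (Num.sqrt 2%:R * (z lA)%:~R + (z lC)%:~R)
  (Num.sqrt 2%:R * (o lA)%:~R + (o lC)%:~R)
  (z lA + z lC - z lB) (o lA + o lC - o lB); last by lia.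
move=> b b01; have [T [_ Tb Tu Td irr]] := iet_sqrt2 b01.
have [x0 [x0d _]] := dom_lattice 0 irr.
have [x [u [v [T' [y [_ _ _ _ [irr' TT']]]]]]] := image_exists irr x0d.
have := up_imageE TT'; have := down_imageE TT'.
rewrite Tb Tu Td !mul1r => <- <-; split; [exact: down_gt0|exact: up_gt0|].
by move=> i j h; have [-> ->] := irr' j i (esym h).
Qed.

(** The determinant of the morphism read on the binary words obtained by writing
    A as 0, B as 01 and C as 1. *)
Definition dphi : int := z lA * o lC - o lA * z lC.

Lemma up_image_additive (T T' : iet R) : (forall Y, len T' Y = imlen phi T Y) ->
  up T' = down T * (o lA)%:~R + up T * (o lC)%:~R.
Proof.
move=> /up_imageE ->; have [_ ->] := counts_additive.
by rewrite subrr mulr0 subr0.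
Qed.

Lemma down_image_additive (T T' : iet R) : (forall Y, len T' Y = imlen phi T Y) ->
  down T' = down T * (z lA)%:~R + up T * (z lC)%:~R.
Proof.
move=> /down_imageE ->; have [-> _] := counts_additive.
by rewrite subrr mulr0 subr0.
Qed.

Lemma shiftw_image (T T' : iet R) X : (forall Y, len T' Y = imlen phi T Y) ->
  shiftw T' (phi [:: X]) = dphi%:~R * shift T X.
Proof.
move=> TT'; rewrite shiftwE (up_image_additive TT') (down_image_additive TT').
rewrite !pmulrn -/(z X) -/(o X) /shift /dphi.
have [zE oE] := counts_additive.
by case: (letterP X) => -> /=; rewrite ?zE ?oE !(rmorphB, rmorphD, rmorphM) /=; ring.
Qed.

Lemma dphi_neq0 : dphi != 0.
Proof.
apply/eqP => d0.
have [T [_ irr _]] := iet_free R.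
have [x0 [x0d _]] := dom_lattice 0 irr.
have [x [u [v [T' [y [_ _ _ _ [irr' TT']]]]]]] := image_exists irr x0d.
have u0 := up_gt0 T'; have d0' := down_gt0 T'.
have dR : (z lA)%:~R * (o lC)%:~R = (o lA)%:~R * (z lC)%:~R :> R.
  by rewrite -!rmorphM /=; congr _%:~R; apply: subr0_eq d0.
move: u0 d0'; rewrite (up_image_additive TT') (down_image_additive TT') => u0 d0'.
have [zA oA] : z lA = 0 /\ o lA = 0.
  apply: irr'; rewrite (up_image_additive TT') (down_image_additive TT').
  by rewrite !mulrDr ![_ * (up T * _)]mulrCA dR; ring.
have [zC oC] : z lC = 0 /\ o lC = 0.
  apply: irr'; rewrite (up_image_additive TT') (down_image_additive TT').
  by rewrite zA oA; ring.
by move: u0; rewrite oA oC !mulr0 addr0 ltxx.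
Qed.

(** The eigenvalue of the left eigenvector [(1, -1, 1)] of the incidence matrix,
    read off its first column. *)
Definition kphi : int := (count_mem lA (phi [:: lA]))%:Z -
  (count_mem lA (phi [:: lB]))%:Z + (count_mem lA (phi [:: lC]))%:Z.

Lemma det_incidence : \det (incidence_mx phi) = kphi * dphi.
Proof.
pose n X Y : int := (count_mem Y (phi [:: X]))%:Z.
have zE X : z X = n X lA + n X lB.
  by rewrite /z; have [_ -> _] := count_letters (phi [:: X]).
have oE X : o X = n X lB + n X lC.
  by rewrite /o; have [_ _ ->] := count_letters (phi [:: X]).
have [zB oB] := counts_additive.
have kE : kphi = n lA lA - n lB lA + n lC lA by [].
have nB Y : n lB Y = n lA Y + n lC Y - (if Y == lB then - kphi else kphi).
  move: zB oB; rewrite !zE !oE kE => zB oB.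
  by case: (letterP Y) => -> /=; lra.
have mE i j : incidence_mx phi i j = n i j by rewrite mxE.
have -> : dphi = (n lA lA + n lA lB) * (n lC lB + n lC lC) -
  (n lA lB + n lA lC) * (n lC lA + n lC lB) by rewrite /dphi !zE !oE.
by rewrite det_mx33 !mE !nB /=; ring.
Qed.

Lemma b_image (T T' : iet R) : (forall Y, len T' Y = imlen phi T Y) ->
  lattice T (iet_b T' - kphi%:~R * iet_b T).
Proof.
move=> TT'.
pose n X Y : int := (count_mem Y (phi [:: X]))%:Z.
have zE X : z X = n X lA + n X lB.
  by rewrite /z; have [_ -> _] := count_letters (phi [:: X]).
have [zB oB] := counts_additive.
have kE : kphi = n lB lB - n lA lB - n lC lB.
  by rewrite /kphi; move: zB; rewrite !zE /n => zB; lra.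
exists (n lC lB), (n lA lB).
have -> : iet_b T' = len T' lB by [].
rewrite TT' /imlen sum_letter kE /len /= /up /down.
by rewrite !(rmorphB) /= !pmulrn -!/(n _ _); ring.
Qed.

End Incidence.

(** * The intervals of an image as tilings *)

Lemma seq_gap (R : realType) (s : seq R) (l : R) :
  exists2 g : R, 0 < g & forall e, e \in s -> l < e -> l + g <= e.
Proof.
elim: s => [|e s [g g0 gP]]; first by exists 1.
have [le|el] := ltP l e.
  exists (Num.min g (e - l)); first by rewrite lt_min g0 subr_gt0.
  move=> e'; rewrite inE => /orP[/eqP -> _|/gP h /h h'].
    by rewrite -lerBrDl ge_min lexx orbT.
  by rewrite -lerBrDl ge_min; apply/orP; left; lra.
exists g => // e'; rewrite inE => /orP[/eqP ->|]; last exact: gP.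
by rewrite ltNge el.
Qed.

Section Tiles.
Variables (R : realType) (phi : seq letter -> seq letter).
Hypotheses (phi_morphism : is_morphism phi) (phi_3iet : preserves_3iet R phi).
Local Notation d := (dphi phi).

Lemma lattice_image (T T' : iet R) z : (forall Y, len T' Y = imlen phi T Y) ->
  lattice T' z -> lattice T z.
Proof.
move=> TT' [i [j ->]].
rewrite (up_image_additive phi_morphism phi_3iet TT') (down_image_additive phi_morphism phi_3iet TT').
exists (i * one_count phi lC + j * zero_count phi lC).
exists (i * one_count phi lA + j * zero_count phi lA).
by rewrite !(rmorphD, rmorphM) /=; ring.
Qed.

Lemma lattice_image_scale (T T' : iet R) z :
  (forall Y, len T' Y = imlen phi T Y) -> lattice T z -> lattice T' (d%:~R * z).
Proof.
move=> TT' [i [j ->]].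
have hA := shiftw_image phi_morphism phi_3iet lA TT'.
have hC := shiftw_image phi_morphism phi_3iet lC TT'.
have -> : d%:~R * (i%:~R * up T + j%:~R * down T) =
    i%:~R * shiftw T' (phi [:: lA]) - j%:~R * shiftw T' (phi [:: lC]).
  by rewrite hA hC /shift /=; ring.
by apply: latticeB; apply: latticeMz; apply: lattice_shiftw.
Qed.

(** The end of the interval of [X] that an affine map of slope [d] sends to the
    left. *)
Definition endpoint (T : iet R) (X : letter) : R :=
  if 0 < d then lo T X else hi T X.

Definition tile (T T' : iet R) (c : R) (X : letter) (j : nat) : R :=
  d%:~R * endpoint T X + c + shiftw T' (take j (phi [:: X])).

Lemma endpoint_lattice (T : iet R) X :
  exists2 s : int, s = 0 \/ s = 1 & lattice T (endpoint T X + s%:~R * iet_b T).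
Proof.
rewrite /endpoint /hi /lo /len; have Lu := lattice_up T.
have Ld := lattice_down T; have Lud := latticeD Lu Ld; have L0 := lattice0 T.
case: (letterP X) => ->; case: (0 < d) => /=.
- by exists 0; [left|rewrite mul0r addr0].
- by exists 1; [right|rewrite mul1r add0r].
- by exists 1; [right|rewrite mul1r].
- by exists 0; [left|rewrite mul0r addr0].
- by exists 0; [left|rewrite mul0r addr0].
- by exists 1; [right|move: Lud; congr lattice; rewrite /up /down; ring].
Qed.

Section Tiling.
Variables (T T' : iet R) (x y : int -> R) (u v : biword).
Hypotheses (xu : trace T x u) (irr : irrational T) (uv : is_image phi u v).
Hypotheses (yv : trace T' y v) (irr' : irrational T').
Hypothesis TT' : forall Y, len T' Y = imlen phi T Y.

Definition intercept : R := y 0 - d%:~R * x 0.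
Local Notation c := intercept.

(** Since the translations of the images of the letters are proportional to those
    of the letters, the orbit at the beginnings of the blocks is an affine image
    of the original orbit. *)
Lemma orbit_affine n : y (pos phi u n) = d%:~R * x n + c.
Proof.
move: n; apply: int_step_ind; first by rewrite /pos prim0 /c; ring.
move=> n.
have e : y (pos phi u (n + 1)) = y (pos phi u n) + d%:~R * shift T (u n).
  rewrite -(shiftw_image phi_morphism phi_3iet (u n) TT') /pos primS -/(pos phi u n).
  by rewrite (trace_block phi_morphism uv yv) // take_size.
by rewrite e (xu n).2; split=> h; lra.
Qed.

Lemma orbit_tile m : exists n j, [/\ (j < size (phi [:: u n]))%N,
  v m = nth lA (phi [:: u n]) j &
  y m = d%:~R * x n + c + shiftw T' (take j (phi [:: u n]))].
Proof.
have [n [j [jn ->]]] := image_cover phi_morphism uv m; exists n, j; split=> //.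
  by rewrite (image_at phi_morphism uv jn).
by rewrite (trace_block phi_morphism uv yv (ltnW jn)) orbit_affine.
Qed.

Lemma endpoint_le n : d%:~R * endpoint T (u n) <= d%:~R * x n.
Proof.
have /itv_bounds xb := (xu n).1; rewrite /endpoint.
case: ltP => h; first by rewrite ler_pM2l ?ltr0z //; lra.
have := dphi_neq0 phi_morphism phi_3iet => d0.
have {}h : d < 0 by rewrite lt_neqAle d0.
by rewrite ler_nM2l ?ltrz0 //; lra.
Qed.

Lemma endpoint_dense X (e : R) : 0 < e ->
  exists n, u n = X /\ d%:~R * x n < d%:~R * endpoint T X + e.
Proof.
move=> e0; have [a0 b0 c0] := abc_gt0 T; rewrite /endpoint.
have len0 : 0 < len T X by rewrite /len; case: (letterP X) => ->.
case: ltP => h.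
  have dR : 0 < d%:~R :> R by rewrite ltr0z.
  have [|||n [un xn]] := @trace_dense_itv _ _ _ _ xu irr X (lo T X)
    (Num.min (hi T X) (lo T X + e / d%:~R)) => //.
  - by rewrite lt_min /hi ltrDl len0 /= ltrDl divr_gt0.
  - by rewrite ge_min lexx.
  exists n; split=> //; move: xn; rewrite lt_min => /and3P[_ _].
  by rewrite -ltrBlDl ltr_pdivlMr // => xn; lra.
have {}h : d < 0 by rewrite lt_neqAle (dphi_neq0 phi_morphism phi_3iet).
have dR : 0 < - d%:~R :> R by rewrite oppr_gt0 ltrz0.
have [|||n [un xn]] := @trace_dense_itv _ _ _ _ xu irr X
    (Num.max (lo T X) (hi T X - e / - d%:~R)) (hi T X) => //.
- by rewrite le_max lexx.
- by rewrite gt_max /hi ltrDl len0 /= ltrBlDr ltrDl divr_gt0.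
exists n; split=> //; move: xn; rewrite gt_max => /andP[/andP[_]].
by rewrite ltrBlDl -ltrBlDr ltr_pdivlMr // => xn _; lra.
Qed.

Lemma tile_left X j : (j < size (phi [:: X]))%N ->
  lo T' (nth lA (phi [:: X]) j) <= tile T T' c X j.
Proof.
move=> jX; rewrite leNgt; apply/negP => h; move: (h); rewrite -subr_gt0 => h0.
have [n [un xn]] := endpoint_dense X h0.
have jn : (j < size (phi [:: u n]))%N by rewrite un.
have := (yv (pos phi u n + j%:Z)).1; rewrite (image_at phi_morphism uv jn).
rewrite (trace_block phi_morphism uv yv (ltnW jn)) orbit_affine un.
by move/itv_bounds; rewrite /tile in xn *; lra.
Qed.

Lemma tile_near Y : exists2 g : R, 0 < g & forall m, v m = Y ->
  y m < lo T' Y + g -> exists n j,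
    [/\ (j < size (phi [:: u n]))%N, tile T T' c (u n) j = lo T' Y &
        y m = d%:~R * x n + c + shiftw T' (take j (phi [:: u n]))].
Proof.
have [g g0 gP] := seq_gap [seq tile T T' c X j | X <- enum 'I_3,
  j <- iota 0 (size (phi [:: X]))] (lo T' Y).
exists g => // m vm ym; have [n [j [jn vn yE]]] := orbit_tile m.
exists n, j; split=> //; apply/eqP; rewrite eq_le.
have := tile_left jn; rewrite -vn vm => -> /=; rewrite andbT leNgt; apply/negP.
move/(gP (tile T T' c (u n) j) _) => h.
have /h : tile T T' c (u n) j \in [seq tile T T' c X j | X <- enum 'I_3,
    j <- iota 0 (size (phi [:: X]))].
  apply/allpairsPdep; exists (u n), j; split=> //; first by rewrite mem_enum.
  by rewrite mem_iota.
by have := endpoint_le n; rewrite /tile; lra.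
Qed.

Lemma near_exists Y (g : R) : 0 < g ->
  exists m, v m = Y /\ lo T' Y < y m < Num.min (hi T' Y) (lo T' Y + g).
Proof.
move=> g0; have [a0 b0 c0] := abc_gt0 T'.
have len0 : 0 < len T' Y by rewrite /len; case: (letterP Y) => ->.
apply: (trace_dense_itv yv irr') => //.
- by rewrite lt_min /hi ltrDl len0 ltrDl.
- by rewrite ge_min lexx.
Qed.

Lemma tile_exists Y : exists X j, (j < size (phi [:: X]))%N /\
  tile T T' c X j = lo T' Y.
Proof.
have [g g0 gP] := tile_near Y; have [m [vm]] := near_exists Y g0.
rewrite lt_min => /and3P[_ _ /(gP _ vm)[n [j [jn e _]]]].
by exists (u n), j.
Qed.

End Tiling.

(** Both ends of the interval of [lB] are ends of tiles, hence, up to the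
    intercept, congruent to [d] times ends of intervals of [T]. Their difference
    [iet_b T'] is thus congruent to 0, [d * iet_b T] or [- (d * iet_b T)], and also to
    [kphi phi * iet_b T]. When [iet_b T] is free modulo the lattice, the coefficients
    must agree. *)
Lemma kphi_dphi : exists2 s : int, s \in [:: 0; 1; -1] & kphi phi = d * s.
Proof.
have [T [_ irr free]] := iet_free R.
have [x0 [x0d _]] := dom_lattice 0 irr.
have [x [u [v [T' [y [_ xu uv yv [irr' TT']]]]]]] :=
  image_exists phi_morphism phi_3iet irr x0d.
have [X1 [j1 [_ e1]]] := tile_exists xu irr uv yv irr' TT' lB.
have [X2 [j2 [_ e2]]] := tile_exists xu irr uv yv irr' TT' lC.
have [s1 s1P h1] := endpoint_lattice T X1.
have [s2 s2P h2] := endpoint_lattice T X2.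
exists (s1 - s2); first by case: s1P => ->; case: s2P => ->.
apply/subr0_eq/free.
have hb := b_image phi_morphism phi_3iet TT'.
have o1 := lattice_image TT' (lattice_shiftw T' (take j1 (phi [:: X1]))).
have o2 := lattice_image TT' (lattice_shiftw T' (take j2 (phi [:: X2]))).
have h := latticeD (latticeMz d (latticeB h2 h1)) (latticeB o2 o1).
move: (latticeB h hb); congr lattice.
have -> : iet_b T' = lo T' lC - lo T' lB by rewrite /lo /=; ring.
by rewrite -e1 -e2 /tile !(rmorphB, rmorphM) /=; ring.
Qed.

Lemma shiftw_eq (T1 T2 : iet R) w : (forall Y, len T1 Y = len T2 Y) ->
  shiftw T1 w = shiftw T2 w.
Proof.
move=> h; rewrite !shiftwE /up /down.
by have := h lA; have := h lB; have := h lC; rewrite /len /= => -> -> ->.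
Qed.

Lemma lo_eq (T1 T2 : iet R) Y : (forall Y, len T1 Y = len T2 Y) -> lo T1 Y = lo T2 Y.
Proof.
by move=> h; have := h lA; have := h lB; rewrite /lo /len /= => -> ->.
Qed.

(** The intercept is forced by the fact that the leftmost tile begins at 0. *)
Lemma intercept_le (T T1 T2 : iet R) x1 x2 y1 y2 u1 u2 v1 v2 : irrational T ->
  trace T x1 u1 -> is_image phi u1 v1 -> trace T1 y1 v1 -> irrational T1 ->
  trace T x2 u2 -> is_image phi u2 v2 -> trace T2 y2 v2 ->
  (forall Y, len T1 Y = imlen phi T Y) -> (forall Y, len T2 Y = imlen phi T Y) ->
  intercept x1 y1 <= intercept x2 y2.
Proof.
move=> irr xu1 uv1 yv1 irr1 xu2 uv2 yv2 TT1 TT2.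
have [X [j [jX e]]] := tile_exists xu1 irr uv1 yv1 irr1 TT1 lA.
have h := tile_left xu2 irr uv2 yv2 TT2 jX.
have h0 : 0 <= lo T2 (nth lA (phi [:: X]) j).
  have [a0 b0 c0] := abc_gt0 T2.
  by move: (nth _ _ _) => Z; rewrite /lo; case: (letterP Z) => -> /=; lra.
move: e h; rewrite /tile (@shiftw_eq T1 T2) => [|Y]; last by rewrite TT1 TT2.
by rewrite {1}/lo /=; lra.
Qed.

(** If [d] is not a unit, the lattice of [T'] has a point [d * w] with [w] not in
    the lattice of [T]. The codings of [x0] and of a point congruent to [x0 + w]
    then have images that code a common orbit, which is cut into blocks in two
    different ways. A point of that orbit slightly to the right of the left end of
    the interval of [lB] belongs to two tiles which both begin there, and
    which are translates of images of intervals with different ends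
    modulo the lattice of [T]; this makes [d * iet_b T] an element of that lattice. *)
Lemma dphi_unit : d = 1 \/ d = -1.
Proof.
have [T [_ irr free]] := iet_free R.
have [p0 [p0d _]] := dom_lattice 0 irr.
have [x0 [u0 [v0 [T0 [y0 [_ xu0 uv0 yv0 [irr0 TT0]]]]]]] :=
  image_exists phi_morphism phi_3iet irr p0d.
have dn0 : d != 0 := dphi_neq0 phi_morphism phi_3iet.
have dR0 : d%:~R != 0 :> R by rewrite intr_eq0.
apply: contrapT => dunit.
have [w [dw wn]] : exists w, lattice T0 (d%:~R * w) /\ ~ lattice T w.
  apply: contrapT => nw.
  have all_in z : lattice T0 z -> lattice T (z / d%:~R).
    move=> Lz; apply: contrapT => nz; apply: nw; exists (z / d%:~R).
    by rewrite mulrC divfK.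
  have [i [j]] := all_in _ (lattice_up T0).
  have [k [l]] := all_in _ (lattice_down T0).
  rewrite (up_image_additive phi_morphism phi_3iet TT0).
  rewrite (down_image_additive phi_morphism phi_3iet TT0).
  move=> /(canRL (divfK dR0)) eD /(canRL (divfK dR0)) eU.
  have [D DE] : exists D, D = d by exists d.
  rewrite -DE in eD eU.
  have [h1 h2] := irr (one_count phi lC - D * i) (D * j - one_count phi lA)
    ltac:(rewrite !(rmorphB, rmorphM) /=; lra).
  have [h3 h4] := irr (zero_count phi lC - D * k) (D * l - zero_count phi lA)
    ltac:(rewrite !(rmorphB, rmorphM) /=; lra).
  have dE : d * (d * (l * i - j * k)) = d * 1.
    rewrite mulr1 [in RHS]/dphi (subr0_eq h1) (subr0_eq h3).
    by rewrite -(subr0_eq h2) -(subr0_eq h4) DE; ring.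
  have {}dE := mulfI dn0 dE.
  have : `|d|%N = 1%N.
    by apply/eqP; rewrite -dvdn1 -(absz1) -dE abszM dvdn_mulr.
  by move=> d1; apply: dunit; lia.
(* An orbit of [T] other than that of [x0], with an image in the same orbit. *)
have [p1 [p1d p1L]] := dom_lattice (x0 0 + w) irr.
have [x1 [u1 [v1 [T1 [y1 [x1E xu1 uv1 yv1 [irr1 TT1]]]]]]] :=
  image_exists phi_morphism phi_3iet irr p1d.
have TT01 Y : len T0 Y = len T1 Y by rewrite TT0 TT1.
have cE : intercept x0 y0 = intercept x1 y1.
  apply/eqP; rewrite eq_le; apply/andP; split.
    exact: (intercept_le irr xu0 uv0 yv0 irr0 xu1 uv1 yv1 TT0 TT1).
  exact: (intercept_le irr xu1 uv1 yv1 irr1 xu0 uv0 yv0 TT1 TT0).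
have [g0 g00 gP0] := tile_near xu0 irr uv0 yv0 TT0 lB.
have [g1 g10 gP1] := tile_near xu1 irr uv1 yv1 TT1 lB.
have g : 0 < Num.min g0 g1 by rewrite lt_min g00.
have [m0 [vm0]] := near_exists yv0 irr0 lB g.
rewrite lt_min => /and3P[ylo yhi].
rewrite -ltrBlDl lt_min !ltrBlDl => /andP[yg0 yg1].
have loE := lo_eq lB TT01.
have yint : y0 m0 \in iet_itv T1 lB.
  by apply: itv_interior; rewrite /hi -loE -TT01 ylo.
have [m1 ym1] : exists m1, y1 m1 = y0 m0.
  apply: (trace_reaches yv1 (itv_dom yint)).
  have L0 := trace_lattice yv0 m0.
  have L1 := lattice_image_scale TT0 p1L.
  have := latticeB (latticeB L0 L1) dw.
  have T01 z : lattice T0 z -> lattice T1 z.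
    have e1 : up T0 = up T1 by rewrite (up_image TT0) (up_image TT1).
    have e2 : down T0 = down T1 by rewrite (down_image TT0) (down_image TT1).
    by rewrite /lattice e1 e2.
  move/T01; congr lattice.
  by move: cE; rewrite /intercept x1E; lra.
have vm1 : v1 m1 = lB by apply: itv_inj (yv1 m1).1 _; rewrite ym1.
have [n0 [j0 [_ t0 e0]]] := gP0 m0 vm0 yg0.
have [|n1 [j1 [_ t1 e1]]] := gP1 m1 vm1; first by rewrite ym1 -loE.
have [s0 s0P h0] := endpoint_lattice T (u0 n0).
have [s1 s1P h1] := endpoint_lattice T (u1 n1).
have xe : x0 n0 - x1 n1 = endpoint T (u0 n0) - endpoint T (u1 n1).
  by apply: (mulfI dR0); move: t0 t1 e0 e1; rewrite ym1 -loE /tile; lra.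
have Lx : ~ lattice T (x0 n0 - x1 n1).
  move=> Lx; apply: wn.
  have k0 := trace_lattice xu0 n0; have k1 := trace_lattice xu1 n1.
  have := latticeD (latticeD (latticeB Lx k0) p1L) k1.
  by rewrite x1E => /latticeN; congr lattice; ring.
have o0 := lattice_image TT0 (lattice_shiftw T0 (take j0 (phi [:: u0 n0]))).
have o1 := lattice_image TT1 (lattice_shiftw T1 (take j1 (phi [:: u1 n1]))).
have Ld : lattice T (d%:~R * (endpoint T (u0 n0) - endpoint T (u1 n1))).
  move: (latticeB o1 o0); congr lattice.
  by move: t0 t1; rewrite -loE cE /tile; lra.
have ds : d * (s0 - s1) = 0.
  apply: free; move: (latticeB (latticeMz d (latticeB h0 h1)) Ld).
  by congr lattice; rewrite rmorphM [X in _ * X * _]rmorphB /=; ring.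
move/eqP: ds; rewrite mulf_eq0 (negbTE dn0) subr_eq0 => /eqP ss.
apply: Lx; rewrite xe; move: (latticeB h0 h1); congr lattice.
by rewrite ss; ring.
Qed.

End Tiles.

(** * Complexity *)

Lemma seq_has_max (R : realType) (s : seq R) (P : pred R) :
  has P s -> exists2 d, d \in s /\ P d & forall e, e \in s -> P e -> e <= d.
Proof.
elim: s => [//|e s IH] /=; have [/IH[d [ds Pd] dmax] _|nP] := boolP (has P s).
  have [/andP[Pe de]|h] := boolP (P e && (d <= e)).
    exists e; first by rewrite mem_head.
    move=> f; rewrite inE => /orP[/eqP -> //|fs Pf].
    exact: le_trans (dmax f fs Pf) de.
  exists d; first by rewrite inE ds orbT.
  move=> f; rewrite inE => /orP[/eqP -> Pe|]; last exact: dmax.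
  by move: h; rewrite Pe -ltNge => /ltW.
rewrite orbF => Pe; exists e; first by rewrite mem_head.
move=> f; rewrite inE => /orP[/eqP -> //|fs Pf].
by move/hasPn: nP => /(_ f fs); rewrite Pf.
Qed.

Lemma trace_iter (R : realType) (T : iet R) x u n k : trace T x u ->
  x (n + k%:Z) = iter k (iet_map T) (x n).
Proof.
move=> xu; elim: k => [|k IH]; first by rewrite addr0.
rewrite iterS -IH (iet_mapE (xu _).1) -(xu _).2.
by rewrite -addn1 PoszD addrA.
Qed.

Section Cuts.
Variables (R : realType) (T : iet R).
Hypothesis T_left : iet_left T.

Definition code (z : R) : letter :=
  if z \in iet_itv T lA then lA else if z \in iet_itv T lB then lB else lC.

Lemma codeE X z : z \in iet_itv T X -> code z = X.
Proof.
move=> zX; rewrite /code; case: ifP => [/itv_inj/(_ zX)//|zA].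
case: ifP => [/itv_inj/(_ zX)//|zB].
by case: (letterP X) zX zA zB => -> // ->.
Qed.

Lemma mem_code z : iet_dom T z -> z \in iet_itv T (code z).
Proof. by move=> /dom_letter[X zX]; rewrite (codeE zX). Qed.

Lemma iter_dom z k : iet_dom T z -> iet_dom T (iter k (iet_map T) z).
Proof. exact: (@iet_iter_dom _ _ _ k%:Z). Qed.

Definition word (n : nat) (z : R) : n.-tuple letter :=
  [tuple code (iter i (iet_map T) z) | i < n].

Lemma word_eq n (u : biword) i z :
  (forall j, (j < n)%N -> code (iter j (iet_map T) z) = u (i + j%:Z)) ->
  factor u i n = word n z.
Proof.
move=> h; apply: (@eq_from_nth _ lA); rewrite size_mkseq ?size_tuple // => j jn.
rewrite nth_mkseq // -h //.
by rewrite -[RHS](tnth_nth _ _ (Ordinal jn)) tnth_mktuple.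
Qed.

Definition cut (k : nat) (X : letter) : R := iter k (iet_inv T) (lo T X).

(** The points which one of the first [n] iterates of [T], the identity included,
    sends to a discontinuity. *)
Definition cuts (n : nat) : seq R :=
  [seq cut k X | k <- iota 0 n, X <- [:: lB; lC]].

Lemma size_cuts n : size (0 :: cuts n) = (2 * n + 1)%N.
Proof. by rewrite /= size_allpairs size_iota mulnC addn1. Qed.

Lemma lo_mem X : lo T X \in iet_itv T X.
Proof.
have [a0 b0 c0] := abc_gt0 T; rewrite mem_itvE T_left lexx /= /hi ltrDl.
by rewrite /len; case: (letterP X) => ->.
Qed.

Lemma cutP k X : iet_dom T (cut k X) /\ iter k (iet_map T) (cut k X) = lo T X.
Proof.
rewrite /cut; elim: k => [|k [IHd IH]] /=; first by split=> //; apply: itv_dom (lo_mem X).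
have [d e] := iet_invP IHd; split=> //.
by rewrite -iterS iterSr e.
Qed.

Lemma iter_map_inj k z z' : iet_dom T z -> iet_dom T z' ->
  iter k (iet_map T) z = iter k (iet_map T) z' -> z = z'.
Proof.
move=> zd zd'; elim: k => [//|k IH] /= e; apply: IH.
by have [_ inj _] := iet_map_bij T; apply: inj e; apply/mem_set; apply: iter_dom.
Qed.

Lemma mem_cutsE n z : z \in cuts n <->
  exists k X, [/\ (k < n)%N, X != lA & z = cut k X].
Proof.
have BC X : (X \in [:: lB; lC]) = (X != lA) by case: (letterP X) => ->.
split=> [/allpairsP[[k X] /= [+ + ->]]|[k [X [kn XA ->]]]].
  by rewrite mem_iota BC; exists k, X.
by apply/allpairsP; exists (k, X); rewrite BC mem_iota.
Qed.

Lemma mem_cuts n k X z : (k < n)%N -> X != lA -> iet_dom T z ->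
  iter k (iet_map T) z = lo T X -> z \in cuts n.
Proof.
move=> kn XA zd e; have [d' e'] := cutP k X.
have -> : z = cut k X by apply: (iter_map_inj (k := k)) => //; rewrite e e'.
by apply/mem_cutsE; exists k, X.
Qed.

Lemma cutsP n z : z \in cuts n ->
  exists k X, [/\ (k < n)%N, X != lA, iet_dom T z & iter k (iet_map T) z = lo T X].
Proof.
move/mem_cutsE => [k [X [kn XA ->]]].
by have [d e] := cutP k X; exists k, X.
Qed.

Lemma cuts_ge0 n z : z \in 0 :: cuts n -> iet_dom T z /\ 0 <= z.
Proof.
have [a0 b0 c0] := abc_gt0 T.
have d0 : iet_dom T 0 by apply/mem_domE; rewrite T_left lexx /total; lra.
rewrite inE => /orP[/eqP -> //|/cutsP[k [X [_ _ zd _]]]].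
by split=> //; move/mem_domE: zd; rewrite T_left => /andP[].
Qed.

(** Two points with the same word move in parallel. When the right one reaches a
    discontinuity, the left one is before it, hence in an interval with another
    letter. *)
Lemma word_inj n : {in 0 :: cuts n &, injective (word n)}.
Proof.
suff lt z z' : z \in 0 :: cuts n -> z' \in 0 :: cuts n -> z < z' ->
    word n z = word n z' -> False.
  move=> z z' zc zc' e; have [h|h|//] := ltgtP z z'; exfalso.
    exact: lt h e.
  exact: lt h (esym e).
move=> zc zc' zz' e; have [zd z0] := cuts_ge0 zc.
have : z' \in cuts n.
  by move: zc'; rewrite inE => /orP[/eqP z'0|//]; move: zz' z0; lra.
move/cutsP => [k [X [kn XA zd' zX]]].
have codes j : (j < n)%N -> code (iter j (iet_map T) z) = code (iter j (iet_map T) z').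
  move=> jn; have := congr1 (fun w => tnth w (Ordinal jn)) e.
  by rewrite !tnth_mktuple.
have diff j : (j <= n)%N ->
    iter j (iet_map T) z' - iter j (iet_map T) z = z' - z.
  elim: j => [//|j IH] jn; have {}IH := IH (ltnW jn).
  rewrite !iterS (iet_mapE (mem_code (iter_dom j zd'))).
  by rewrite (iet_mapE (mem_code (iter_dom j zd))) codes //; lra.
have := mem_code (iter_dom k zd); rewrite (codes k kn) zX (codeE (lo_mem X)).
rewrite mem_itvE T_left => /andP[h _].
by have := diff k (ltnW kn); rewrite zX; lra.
Qed.

Variables (T0 : iet R) (x : int -> R) (u : biword).
Hypotheses (xu : trace T0 x u) (irr : irrational T0).
Hypothesis T0T : forall X, len T0 X = len T X.

(** On the left of a point of the orbit of [u], as far as the nearest cut, the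
    points move along with it during [n] steps. *)
Lemma follow n i d :
  let below e := if iet_left T0 then e <= x i else e < x i in
  0 <= d -> below d ->
  (forall e, e \in cuts n -> d < e -> ~~ below e) ->
  forall j, (j < n)%N -> code (iter j (iet_map T) d) = u (i + j%:Z).
Proof.
move=> below d0 bd nocut.
have totE : total T0 = total T.
  by have := T0T lA; have := T0T lB; have := T0T lC; rewrite /len /total /= => -> -> ->.
have loE X : lo T0 X = lo T X := lo_eq X T0T.
have hiE X : hi T0 X = hi T X by rewrite /hi loE T0T.
have edom e : d <= e -> below e -> iet_dom T e.
  move=> de; rewrite /below => be; apply/mem_domE; rewrite T_left -totE.
  by have /mem_domE := trace_dom xu i; move: be; case: (iet_left T0); lra.
have step j : (j < n)%N ->
    (forall e, d <= e -> below e -> iter j (iet_map T) e = x (i + j%:Z) - (x i - e)) ->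
    forall e, d <= e -> below e -> iter j (iet_map T) e \in iet_itv T (u (i + j%:Z)).
  move=> jn S e de be; set X := u _.
  have xX := (xu (i + j%:Z)).1; rewrite mem_itvE loE hiE -/X in xX.
  have lX : lo T X <= iter j (iet_map T) d.
    rewrite leNgt; apply/negP => h.
    pose e' := d + (lo T X - iter j (iet_map T) d).
    have dj := S d (lexx d) bd.
    have be' : below e'.
      by move: xX; rewrite /below /e' dj; case: (iet_left T0); lra.
    have de' : d < e' by rewrite /e'; lra.
    have e'X : iter j (iet_map T) e' = lo T X.
      by rewrite (S e' (ltW de') be') /e' dj; lra.
    have XA : X != lA.
      apply: contraTneq h => ->; rewrite -leNgt {1}/lo /=.
      have /mem_domE := iter_dom j (edom d (lexx d) bd).
      by rewrite T_left => /andP[].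
    have := nocut e' (mem_cuts jn XA (edom e' (ltW de') be') e'X) de'.
    by rewrite be'.
  rewrite mem_itvE T_left; have dj := S d (lexx d) bd; have ej := S e de be.
  move: xX be; rewrite /below; case: (iet_left T0); lra.
have S j : (j <= n)%N -> forall e, d <= e -> below e ->
    iter j (iet_map T) e = x (i + j%:Z) - (x i - e).
  elim: j => [|j IH] jn e de be; first by rewrite addr0 subKr.
  have {}IH := IH (ltnW jn).
  rewrite iterS (iet_mapE (step j jn IH e de be)) (IH e de be).
  have -> : i + j.+1%:Z = i + j%:Z + 1 by lia.
  rewrite (xu _).2 /shift /up /down.
  have := T0T lA; have := T0T lB; have := T0T lC; rewrite /len /= => -> -> ->.
  by ring.
move=> j jn; apply: codeE; apply: step => //; exact: (S j (ltnW jn)).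
Qed.

(** The word read at a point of the orbit is that of the nearest cut on its left,
    and conversely the orbit has points just to the right of any cut. *)
Lemma complexity_cuts n : complexity u n = size (undup (0 :: cuts n)).
Proof.
pose W := [seq word n z | z <- undup (0 :: cuts n)].
have Wuniq : uniq W.
  rewrite map_inj_in_uniq ?undup_uniq // => z z'; rewrite !mem_undup.
  exact: word_inj.
rewrite -(size_map (word n)) -/W -(card_uniqP Wuniq); apply: eq_card => w.
rewrite inE; apply/asboolP/mapP => [[i iw]|[d]].
  pose below e := if iet_left T0 then e <= x i else e < x i.
  have h0 : has below (0 :: cuts n).
    apply/orP; left; have /mem_domE := trace_dom xu i.
    by rewrite /below; case: (iet_left T0) => /andP[].
  have [d [dc bd] dmax] := seq_has_max h0.
  exists d; first by rewrite mem_undup.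
  apply: val_inj; rewrite /= -iw; apply: word_eq; apply: follow => //.
    by have [] := cuts_ge0 dc.
  move=> e ec de; apply: contraTN de => be; rewrite -leNgt; apply: dmax be.
  by rewrite inE ec orbT.
rewrite mem_undup => dc ->; have [dd d0] := cuts_ge0 dc.
have [g g0 gP] := seq_gap (cuts n) d.
have totE : total T0 = total T.
  by have := T0T lA; have := T0T lB; have := T0T lC; rewrite /len /total /= => -> -> ->.
have [|||i] := @trace_dense _ _ _ _ xu irr d (Num.min (total T0) (d + g)) => //.
- rewrite lt_min totE ltrDl g0 andbT.
  by move/mem_domE: dd; rewrite T_left => /andP[].
- by rewrite ge_min lexx.
rewrite lt_min => /and3P[di _ ig]; exists i; apply: word_eq; apply: follow => //.
  by case: ifP => _ //; apply: ltW.
move=> e ec de; have := gP e ec de; case: ifP => _; lra.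
Qed.

End Cuts.

Section Degeneracy.
Variables (R : realType) (T : iet R) (x : int -> R) (u : biword).
Hypotheses (xu : trace T x u) (irr : irrational T).

Let T' : iet R := Iet true (iet_a_gt0 T) (iet_b_gt0 T) (iet_c_gt0 T).

Let complexityE n : complexity u n = size (undup (0 :: cuts T' n)).
Proof. by apply: (complexity_cuts (T := T') erefl xu irr). Qed.

Let latticeE z : lattice T z = lattice T' z. Proof. by []. Qed.

Let irr' : irrational T'. Proof. exact: irr. Qed.

Lemma orbit_lattice z k : iet_dom T' z ->
  lattice T' (iter k (iet_map T') z - z).
Proof.
move=> /trace_exists[x' [u' [x'0 xu' _]]]; have := trace_lattice xu' k.
by have := trace_iter 0 k xu'; rewrite add0r x'0 => ->.
Qed.

Lemma orbit_inj z k l : iet_dom T' z ->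
  iter k (iet_map T') z = iter l (iet_map T') z -> k = l.
Proof.
move=> /trace_exists[x' [u' [x'0 xu' _]]].
rewrite -x'0 -!(trace_iter _ _ xu') => /(trace_inj xu' irr'); lia.
Qed.

(** The orbits of the two discontinuities are disjoint and never
    return, so that all the cuts are distinct. *)
Lemma complexity_nondegenerate : ~ lattice T (iet_b T) ->
  forall n, complexity u n = (2 * n + 1)%N.
Proof.
move=> bL n; rewrite complexityE -(size_cuts T'); congr size; apply: undup_id.
have Tl : iet_left T' by [].
have BC : ~ lattice T' (lo T' lC - lo T' lB).
  by rewrite /lo /= addrAC subrr add0r.
have mapC : iet_map T' (lo T' lC) = 0.
  by rewrite (iet_mapE (lo_mem Tl lC)) /lo /shift /down /=; ring.
rewrite /= ; apply/andP; split.
  apply/negP => /(cutsP Tl)[k [X [_ XA d0 e]]].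
  have := orbit_lattice k d0; rewrite e subr0.
  case: (letterP X) XA e => -> //= _ e.
    move/(latticeB (lattice_down T')) => h; apply: BC; move: h.
    by congr lattice; rewrite /lo /down /=; ring.
  by have := @orbit_inj 0 k.+1 0 d0; rewrite iterS e mapC => /(_ erefl).
apply: allpairs_uniq => //; first exact: iota_uniq.
move=> p q hp hq; case/allpairsP: hp => [[k' X'] /= [_ XBC ->]].
case/allpairsP: hq => [[l' Y'] /= [_ YBC ->]] /= e.
have [d1 e1] := cutP Tl k' X'; have [d2 e2] := cutP Tl l' Y'.
rewrite -e in d2 e2.
have XY : X' = Y'.
  have := latticeB (orbit_lattice k' d1) (orbit_lattice l' d2).
  rewrite e1 e2 => h; move: XBC YBC h.
  case: (letterP X') => ->; case: (letterP Y') => -> //= _ _ h; exfalso; apply: BC.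
    by move/latticeN: h; congr lattice; ring.
  by move: h; congr lattice; ring.
by congr pair => //; apply: orbit_inj d1 _; rewrite e1 e2 XY.
Qed.

(** The discontinuities then lie on a common orbit, and two cuts coincide. *)
Lemma complexity_degenerate : lattice T (iet_b T) ->
  ~ forall n, complexity u n = (2 * n + 1)%N.
Proof.
move=> bL.
have Tl : iet_left T' by [].
have rep k X Y : X != Y -> X != lA -> Y != lA ->
    (0 < k)%N -> iter k (iet_map T') (lo T' X) = lo T' Y ->
    ~ forall n, complexity u n = (2 * n + 1)%N.
  move=> XY XA YA k0 e /(_ k.+1); rewrite complexityE => sz.
  have [d1 e1] := cutP Tl k Y.
  have Xd : iet_dom T' (lo T' X) := itv_dom (lo_mem Tl X).
  have cY : cut T' k Y = lo T' X.
    by apply: (iter_map_inj (T := T') (k := k)); rewrite ?e1.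
  have sub : {subset undup (0 :: cuts T' k.+1) <= cut T' k X :: 0 :: cuts T' k}.
    move=> z; rewrite mem_undup in_cons => /orP[/eqP ->|]; first by rewrite in_cons mem_head orbT.
    move/mem_cutsE => [l [Z [+ ZA ->]]]; rewrite !in_cons ltnS leq_eqVlt => /orP[/eqP ->|lk].
      have [->|ZX] := eqVneq Z X; first by rewrite eqxx.
      have -> : Z = Y.
        by move: ZX XY ZA XA YA; case: (letterP X) => ->; case: (letterP Y) => ->;
          case: (letterP Z) => ->.
      by rewrite cY (mem_cuts Tl k0 XA Xd) ?orbT.
    suff -> : cut T' l Z \in cuts T' k by rewrite !orbT.
    by apply/mem_cutsE; exists l, Z.
  have := uniq_leq_size (undup_uniq _) sub.
  by rewrite sz /= -[X in (_ <= X.+1)%N]/(size (0 :: cuts T' k)) size_cuts; lia.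
have [x' [u' [x'0 xu' _]]] := trace_exists (itv_dom (lo_mem Tl lB)).
have [m x'm] : exists m, x' m = lo T' lC.
  apply: (trace_reaches xu' (itv_dom (lo_mem Tl lC))); rewrite x'0.
  by move: bL; rewrite latticeE; congr lattice; rewrite /lo /=; ring.
have m0 : m != 0.
  apply/eqP => m0; move: x'm; rewrite m0 x'0 /lo /=.
  by have := iet_b_gt0 T; lra.
have [mp|mn] := ltP 0 m.
  apply: (rep `|m|%N lB lC) => //; first by lia.
  have -> : lo T' lB = x' 0 by rewrite x'0.
  by rewrite -(trace_iter 0 _ xu') add0r -x'm; congr x'; lia.
apply: (rep `|m|%N lC lB) => //; first by lia.
rewrite -x'm -(trace_iter m _ xu') -x'0; congr x'; lia.
Qed.

End Degeneracy.

(** * Degeneracy of the images *)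

Section Conclusion.
Variables (R : realType) (phi : seq letter -> seq letter).
Hypotheses (phi_morphism : is_morphism phi) (phi_3iet : preserves_3iet R phi).

Lemma lattice_imageE (T T' : iet R) z : (forall Y, len T' Y = imlen phi T Y) ->
  lattice T' z <-> lattice T z.
Proof.
move=> TT'; split; first exact: (lattice_image phi_morphism phi_3iet TT').
move/(lattice_image_scale phi_morphism phi_3iet TT').
have [->|->] := dphi_unit phi_morphism phi_3iet; first by rewrite mul1r.
by rewrite mulN1r => /latticeN; rewrite opprK.
Qed.

(** The degeneracy of the coding of [T] is the membership of [iet_b T] in the
    lattice, so its behaviour under [phi] is read off [b_image]. *)
Lemma image_degeneracy u : is_3iet_word R u ->
  exists v (T T' : iet R), [/\ is_image phi u v, is_3iet_word R v,
    forall Y, len T' Y = imlen phi T Y,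
    lattice T (iet_b T) <-> ~ forall n, complexity u n = (2 * n + 1)%N &
    lattice T' (iet_b T') <-> ~ forall n, complexity v n = (2 * n + 1)%N].
Proof.
have char w (S : iet R) t : trace S t w -> irrational S ->
    lattice S (iet_b S) <-> ~ forall n, complexity w n = (2 * n + 1)%N.
  move=> tw irr; split; first exact: complexity_degenerate tw irr.
  by move=> nw; apply: contrapT => /(complexity_nondegenerate tw irr).
move=> u3; have [T [x [xu irr]]] := is_3iet_trace u3.
have [v uv v3] := phi_3iet u3.
have [T' [y [yv irr' TT']]] := image_trace phi_morphism uv xu irr v3.
by exists v, T, T'; split=> //; [exact: char xu irr|exact: char yv irr'].
Qed.

End Conclusion.

Theorem theoremB (R : realType) (phi : seq letter -> seq letter)
    (phi_morphism : is_morphism phi) (phi_3iet : preserves_3iet R phi) :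
  (\det (incidence_mx phi) \in [:: 1; -1] /\
   forall u, nondegenerated_3iet_word R u ->
     exists2 v, is_image phi u v & nondegenerated_3iet_word R v)
  \/
  (\det (incidence_mx phi) = 0 /\
   forall u, is_3iet_word R u ->
     exists2 v, is_image phi u v & degenerated_3iet_word R v).
Proof.
have detE := det_incidence phi_morphism phi_3iet.
have d1 := dphi_unit phi_morphism phi_3iet.
have [s sP ks] := kphi_dphi phi_morphism phi_3iet.
have [k0|kn0] := eqVneq (kphi phi) 0; [right|left].
  split=> [|u u3]; first by rewrite detE k0 mul0r.
  have [v [T [T' [uv v3 TT' _ degv]]]] := image_degeneracy phi_morphism phi_3iet u3.
  exists v => //; split=> //; apply/degv.
  rewrite (lattice_imageE phi_morphism phi_3iet _ TT').
  by have := b_image phi_morphism phi_3iet TT'; rewrite k0 mul0r subr0.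
have k1 : kphi phi = 1 \/ kphi phi = -1.
  by move: ks kn0; case: d1 => ->; move: sP;
    rewrite !inE => /or3P[] /eqP -> -> //= _; [left|right|right|left].
split=> [|u [u3 nu]].
  by rewrite detE; case: d1 => ->; case: k1 => ->.
have [v [T [T' [uv v3 TT' degu degv]]]] := image_degeneracy phi_morphism phi_3iet u3.
exists v => //; split=> //; apply: contrapT => /degv.
rewrite (lattice_imageE phi_morphism phi_3iet _ TT') => Lb'.
suff /degu : lattice T (iet_b T) by [].
have := latticeB Lb' (b_image phi_morphism phi_3iet TT'); rewrite subKr.
by case: k1 => ->; rewrite ?mul1r // mulN1r => /latticeN; rewrite opprK.
Qed.
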